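(* For every GMV-algebra $\mathbf L$, the lattice of convex subalgebras of $\mathbf L$ is isomorphic to the lattice of convex $\ell$-subgroups of some $\ell$-group. Likewise, for every GMV-algebra $\mathbf L$, the lattice of normal convex subalgebras of $\mathbf L$ is isomorphic to the lattice of normal convex $\ell$-subgroups of some $\ell$-group.
   Context: A residuated lattice is an algebra $\mathbf L=(L,\cdot,\backslash,/,\vee,\wedge,\mathrm e)$ such that $(L,\cdot,\mathrm e)$ is a monoid, $(L,\vee,\wedge)$ is a lattice with order $\le$, and $x\cdot y\le z \iff y\le x\backslash z \iff x\le z/y$ for all $x,y,z\in L$. A GMV-algebra is a residuated lattice satisfying the identities $x/((y\backslash x)\wedge \mathrm e)\approx x\vee y\approx((x/y)\wedge \mathrm e)\backslash x$; equivalently, $x\le y$ implies $x/(y\backslash x)=y=(x/y)\backslash x$. (No bounds and no commutativity or integrality are assumed.) A convex subalgebra of $\mathbf L$ is a subalgebra (closed under all operations, containing $\mathrm e$) whose universe is order-convex. A convex subalgebra $H$ is normal if $(y\backslash xy)\wedge \mathrm e\in H$ and $(yx/y)\wedge \mathrm e\in H$ for all $x\in H$, $y\in L$. Convex subalgebras, respectively normal convex subalgebras, are ordered by inclusion. An $\ell$-group is a lattice-ordered group (not necessarily Abelian); a convex $\ell$-subgroup is a subgroup that is a sublattice and is order-convex, and it is normal if it is normal as a subgroup. *)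

(* Defs.v *)
From HB Require Import structures.
From mathcomp Require Import all_boot all_order.
From mathcomp Require Import boolp classical_sets.

Set Implicit Arguments.
Unset Strict Implicit.
Unset Printing Implicit Defensive.

Import Order.Theory.
Local Open Scope group_scope.
Local Open Scope order_scope.

(* No compatibility between product and order is assumed here; residuated     *)
(* lattices and lattice-ordered groups each add their own.                    *)
#[short(type="latticeMonoidType")]
HB.structure Definition LatticeMonoid d :=
  { T of Monoid T & Order.Lattice d T }.

(* [ldiv x z] is the left residual x\z and [rdiv z y] the right residual z/y; *)
(* the infix [/] of [group_scope] is reserved for division in a group.        *)
HB.mixin Record isResiduated d T of LatticeMonoid d T := {
  ldiv : T -> T -> T;
  rdiv : T -> T -> T;
  ldivP : forall x y z : T, (x * y <= z) = (y <= ldiv x z);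
  rdivP : forall x y z : T, (x * y <= z) = (x <= rdiv z y)
}.

#[short(type="residuatedLatticeType")]
HB.structure Definition ResiduatedLattice d :=
  { T of LatticeMonoid d T & isResiduated d T }.

HB.mixin Record isGMV d T of ResiduatedLattice d T := {
  rdivE : forall x y : T, rdiv x (ldiv y x `&` 1) = x `|` y;
  ldivE : forall x y : T, ldiv (rdiv x y `&` 1) x = x `|` y
}.

#[short(type="gmvAlgebraType")]
HB.structure Definition GMVAlgebra d :=
  { T of isGMV d T & ResiduatedLattice d T }.

HB.mixin Record isLatticeOrdered d T of Group T & Order.Lattice d T := {
  leg_mul2l : forall z x y : T, x <= y -> z * x <= z * y;
  leg_mul2r : forall z x y : T, x <= y -> x * z <= y * z
}.

#[short(type="lgroupType")]
HB.structure Definition LGroup d :=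
  { T of Group T & Order.Lattice d T & isLatticeOrdered d T }.

Definition order_convex d (T : porderType d) (H : set T) : Prop :=
  forall a b x : T, H a -> H b -> a <= x -> x <= b -> H x.

Definition sublattice d (T : latticeType d) (H : set T) : Prop :=
  forall x y : T, H x -> H y -> H (x `|` y) /\ H (x `&` y).

Section ResiduatedSubsets.
Variables (d : Order.disp_t) (L : residuatedLatticeType d).

Definition subalgebra (H : set L) : Prop :=
  [/\ H 1,
      forall x y : L, H x -> H y -> H (x * y),
      forall x y : L, H x -> H y -> H (ldiv x y),
      forall x y : L, H x -> H y -> H (rdiv x y)
    & sublattice H].

Definition convex_subalgebra (H : set L) : Prop :=
  subalgebra H /\ order_convex H.

Definition normal_convex_subalgebra (H : set L) : Prop :=
  convex_subalgebra H /\
  forall x y : L, H x ->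
    H (ldiv y (x * y) `&` 1) /\ H (rdiv (y * x) y `&` 1).

End ResiduatedSubsets.

Section LGroupSubsets.
Variables (d : Order.disp_t) (G : lgroupType d).

Definition subgroup (H : set G) : Prop :=
  [/\ H 1,
      forall x y : G, H x -> H y -> H (x * y)
    & forall x : G, H x -> H x^-1].

Definition convex_lsubgroup (H : set G) : Prop :=
  [/\ subgroup H, sublattice H & order_convex H].

Definition normal_convex_lsubgroup (H : set G) : Prop :=
  convex_lsubgroup H /\ forall x y : G, H x -> H (x ^ y).

End LGroupSubsets.

(* Each of the four collections of subsets above is closed under arbitrary    *)
(* intersections, the empty one being the whole carrier; ordered by inclusion *)
(* it is a lattice, with join the least member containing both arguments.     *)
Record closure_system (T : Type) := ClosureSystem {
  closed_sets :> set T -> Prop;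
  closed_bigcap : forall F : set (set T),
    (F `<=` closed_sets)%classic -> closed_sets (\bigcap_(H in F) H)%classic
}.

Definition closed_set (T : Type) (C : closure_system T) : Type :=
  {H : set T | `[< C H >]}.

Section ClosedSetLattice.
Variables (T : Type) (C : closure_system T).

HB.instance Definition _ := SubChoice.on (closed_set C).
HB.instance Definition _ :=
  [SubChoice_isSubPOrder of closed_set C by <: with set_display].

Lemma closed_setP (H : closed_set C) : C (val H).
Proof. exact/asboolP/(valP H). Qed.

Lemma closed_set_leE (H K : closed_set C) :
  (H <= K) = `[< (val H `<=` val K)%classic >].
Proof. by rewrite -(Order.le_val H K). Qed.

Definition closed_meet_set (H K : closed_set C) : set T :=
  (\bigcap_(M in [set val H; val K]) M)%classic.

Definition closed_join_set (H K : closed_set C) : set T :=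
  (\bigcap_(M in [set M | C M /\ val H `|` val K `<=` M]) M)%classic.

Lemma closed_meet_subproof (H K : closed_set C) : `[< C (closed_meet_set H K) >].
Proof.
by apply/asboolP/closed_bigcap => M [] ->; apply: closed_setP.
Qed.

Lemma closed_join_subproof (H K : closed_set C) : `[< C (closed_join_set H K) >].
Proof. by apply/asboolP/closed_bigcap => M []. Qed.

Definition closed_meet (H K : closed_set C) : closed_set C :=
  exist _ (closed_meet_set H K) (closed_meet_subproof H K).

Definition closed_join (H K : closed_set C) : closed_set C :=
  exist _ (closed_join_set H K) (closed_join_subproof H K).

Lemma closed_meetP (M H K : closed_set C) :
  (M <= closed_meet H K) = (M <= H) && (M <= K).
Proof.
rewrite !closed_set_leE; apply/asboolP/andP => [MHK|[/asboolP MH /asboolP MK]].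
  by split; apply/asboolP => x /MHK; apply; [left|right].
by move=> x Mx _ [] ->; [apply: MH|apply: MK].
Qed.

Lemma closed_joinP (H K M : closed_set C) :
  (closed_join H K <= M) = (H <= M) && (K <= M).
Proof.
rewrite !closed_set_leE; apply/asboolP/andP => [HKM|[/asboolP HM /asboolP KM]].
  by split; apply/asboolP => x Hx; apply: HKM => N [_]; apply; [left|right].
move=> x; apply; split; first exact: closed_setP.
by move=> y [/HM|/KM].
Qed.

HB.instance Definition _ := Order.POrder_MeetJoin_isLattice.Build
  set_display (closed_set C) closed_meetP closed_joinP.

End ClosedSetLattice.

Section Lattices.
Local Open Scope classical_set_scope.

Lemma bigcap_order_convex d (T : porderType d) (F : set (set T)) :
  (forall H, F H -> order_convex H) -> order_convex (\bigcap_(H in F) H).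
Proof.
move=> FH a b x Ha Hb ax xb H FH'.
by apply: (FH H FH' a b x) => //; [apply: Ha|apply: Hb].
Qed.

Lemma bigcap_sublattice d (T : latticeType d) (F : set (set T)) :
  (forall H, F H -> sublattice H) -> sublattice (\bigcap_(H in F) H).
Proof.
move=> FH x y Hx Hy.
by split=> H FH'; case: (FH H FH' x y (Hx _ FH') (Hy _ FH')).
Qed.

Variables (d : Order.disp_t).

Lemma bigcap_convex_subalgebra (L : residuatedLatticeType d)
    (F : set (set L)) :
  F `<=` @convex_subalgebra d L -> convex_subalgebra (\bigcap_(H in F) H).
Proof.
move=> FH; split; last by apply: bigcap_order_convex => H /FH[].
split; last by apply: bigcap_sublattice => H /FH[[]].
- by move=> H /FH[[]].
- by move=> x y Hx Hy H FH'; case: (FH _ FH') => -[_ h _ _ _] _;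
    apply: h; [apply: Hx|apply: Hy].
- by move=> x y Hx Hy H FH'; case: (FH _ FH') => -[_ _ h _ _] _;
    apply: h; [apply: Hx|apply: Hy].
- by move=> x y Hx Hy H FH'; case: (FH _ FH') => -[_ _ _ h _] _;
    apply: h; [apply: Hx|apply: Hy].
Qed.

Lemma bigcap_normal_convex_subalgebra (L : residuatedLatticeType d)
    (F : set (set L)) :
  F `<=` @normal_convex_subalgebra d L ->
  normal_convex_subalgebra (\bigcap_(H in F) H).
Proof.
move=> FH; split; first by apply: bigcap_convex_subalgebra => H /FH[].
move=> x y Hx.
by split=> H FH'; case: (FH _ FH') => _ /(_ x y (Hx _ FH'))[].
Qed.

Lemma bigcap_convex_lsubgroup (G : lgroupType d) (F : set (set G)) :
  F `<=` @convex_lsubgroup d G -> convex_lsubgroup (\bigcap_(H in F) H).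
Proof.
move=> FH; split.
- split.
  + by move=> H /FH[[]].
  + by move=> x y Hx Hy H FH'; case: (FH _ FH') => -[_ h _] _ _;
      apply: h; [apply: Hx|apply: Hy].
  + by move=> x Hx H FH'; case: (FH _ FH') => -[_ _ h] _ _; apply: h; apply: Hx.
- by apply: bigcap_sublattice => H /FH[].
- by apply: bigcap_order_convex => H /FH[].
Qed.

Lemma bigcap_normal_convex_lsubgroup (G : lgroupType d) (F : set (set G)) :
  F `<=` @normal_convex_lsubgroup d G ->
  normal_convex_lsubgroup (\bigcap_(H in F) H).
Proof.
move=> FH; split; first by apply: bigcap_convex_lsubgroup => H /FH[].
by move=> x y Hx H FH'; case: (FH _ FH') => _; apply; apply: Hx.
Qed.

Definition convex_subalgebras (L : residuatedLatticeType d) :=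
  ClosureSystem (@bigcap_convex_subalgebra L).

Definition normal_convex_subalgebras (L : residuatedLatticeType d) :=
  ClosureSystem (@bigcap_normal_convex_subalgebra L).

Definition convex_lsubgroups (G : lgroupType d) :=
  ClosureSystem (@bigcap_convex_lsubgroup G).

Definition normal_convex_lsubgroups (G : lgroupType d) :=
  ClosureSystem (@bigcap_normal_convex_lsubgroup G).

End Lattices.

Definition lattice_isomorphic d (T : latticeType d) d' (T' : latticeType d') :
  Prop := exists f : {lmorphism T -> T'}, bijective f.

(* Main.v *)
From HB Require Import structures.
Require Import Defs.
From mathcomp Require Import all_boot all_order generic_quotient.
From mathcomp Require Import boolp classical_sets.

(* Let N be the negative cone of a GMV-algebra L, an integral GMV-algebra.    *)
(* Positive elements of L are invertible, so convex subalgebras of L          *)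
(* correspond to filters of N (up-closed submonoids), normal ones to normal   *)
(* filters.                                                                   *)
(*                                                                            *)
(* N embeds in the negative cone of an l-group as follows (Bosbach). On words *)
(* over N, the residual x\y extends letter by letter through                  *)
(*   (uv)\w = v\(u\w)  and  u\(vw) = (u\v)((v\u)\w),                          *)
(* and the identity (u\v)\(u\w) = (v\u)\(v\w) extends from letters to words   *)
(* exactly. Two words u, v are identified when u\v and v\u consist of 1s. The *)
(* same congruence is generated by the rules [a; b] = [c] for c <= a and      *)
(* b = a\c, and this presentation is invariant under exchanging left and      *)
(* right; hence the quotient monoid P is cancellative on both sides. Moreover *)
(* aP = Pa for all a in P, so P has a group of fractions, which is an l-group *)
(* with negative cone P.                                                      *)
(*                                                                            *)
(* Finally, a product of letters k_1 ... k_n lies below a letter m in the     *)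
(* l-group iff it does in N, so filters of N correspond to convex             *)
(* l-subgroups.                                                               *)

Set Implicit Arguments.
Unset Strict Implicit.
Unset Printing Implicit Defensive.

Import Order.Theory.
Local Open Scope quotient_scope.
Local Open Scope group_scope.
Local Open Scope order_scope.

(** * Words and word reversing *)

(** Both halves of the theorem compose two inclusion-preserving bijections that pass through the
    filters of the negative cone N of L.

    On the side of L, elements above 1 are units ([gmv_pos_unit]). Hence for k in N the conditions x
    k <= 1 and k x <= 1 agree ([mul_le1C]), and the intervals from k to 1/k, with k in a filter,
    make up a convex subalgebra whose negative part is that filter ([neg_genP], [neg_genK]).

    On the side of the group, words over N modulo [weq] form the negative cone P of the l-group
    [envelope]. Left cancellation and least common multiples in P are computed by residuals of words
    ([weqP], [weq_lcm_least]). Right cancellation follows by reversing words, since [factors] can be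
    stated with either residual ([factorsE]). Normality aP = Pa is checked on letters
    ([letter_moveL], [letter_moveR]) and provides conjugation, so that fractions multiply.

    The map [env] from N to the envelope preserves order but not products: env x env y may be
    strictly below env (x y). It does respect residuals ([env_res]), and this suffices for
    [env_word_le]: a product of members of a filter lies below no letter outside the filter.
    Normality is transferred by expressing conjugates through residuals ([normal_filter_conj],
    [normal_filter_commute]). *)

Section WordCongruence.
Variables (M : Type) (e : M) (E : M -> M -> M -> Prop).

(** The relations [E] are a parameter so that the same theory serves the left residual and, on
    reversed words, the right one. *)
Inductive weq : seq M -> seq M -> Prop :=
| weq_refl u : weq u u
| weq_sym u v : weq u v -> weq v u
| weq_trans v u w : weq u v -> weq v w -> weq u w
| weq_cat u u' v v' : weq u u' -> weq v v' -> weq (u ++ v) (u' ++ v')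
| weq_one : weq [:: e] [::]
| weq_rule a b c : E a b c -> weq [:: a; b] [:: c].

Lemma weq_cat2l u v w : weq v w -> weq (u ++ v) (u ++ w).
Proof. by apply: weq_cat; apply: weq_refl. Qed.

Lemma weq_cat2r u v w : weq v w -> weq (v ++ u) (w ++ u).
Proof. by move=> vw; apply: weq_cat => //; apply: weq_refl. Qed.

End WordCongruence.

Lemma weq_rev (M : Type) (e : M) (E E' : M -> M -> M -> Prop) u v :
  (forall a b c, E a b c -> E' b a c) -> weq e E u v ->
  weq e E' (rev u) (rev v).
Proof.
move=> EE'; elim=> {u v} [u|u v _|v u w _ uv _|u u' v v' _ uu' _|| a b c Eabc].
- exact: weq_refl.
- exact: weq_sym.
- exact: weq_trans.
- by rewrite !rev_cat => vv'; apply: weq_cat.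
- exact: weq_one.
- by apply: weq_rule; apply: EE'.
Qed.

Section Reversing.
Variables (M : eqType) (e : M) (r : M -> M -> M).
Hypothesis rxx : forall x, r x x = e.
Hypothesis r1x : forall x, r e x = x.
Hypothesis rx1 : forall x, r x e = e.
Hypothesis r_cyc : forall x y z, r (r x y) (r x z) = r (r y x) (r y z).

(** Word reversing: [r] is x\y on letters, and after y has been passed, [r y x] is what remains of x
    to act on the rest of the word. *)
Fixpoint lres (x : M) (w : seq M) : seq M :=
  if w is y :: w' then r x y :: lres (r y x) w' else [::].

Fixpoint wres (u w : seq M) : seq M :=
  if u is x :: u' then wres u' (lres x w) else w.

Definition trivial_word (w : seq M) := all (pred1 e) w.

Lemma wres_cat_l u v w : wres (u ++ v) w = wres v (wres u w).
Proof. by elim: u w => //= x u IH w; rewrite IH. Qed.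

Lemma wres_nil u : wres u [::] = [::].
Proof. by elim: u. Qed.

Lemma wres_cons_r v x u : wres v (x :: u) = wres v [:: x] ++ wres (lres x v) u.
Proof. by elim: v x u => //= y v IH x u; rewrite IH. Qed.

Lemma wres_cat_r u v w : wres u (v ++ w) = wres u v ++ wres (wres v u) w.
Proof.
elim: v u => [|x v IH] u /=; first by rewrite wres_nil.
by rewrite wres_cons_r IH catA -wres_cons_r.
Qed.

(** Two more uses of [r_cyc] turn the tail into the same law for z\x and z\y, so x and y must vary
    in the induction. *)
Lemma wres_cyc1 x y w :
  wres (wres [:: x] [:: y]) (wres [:: x] w) =
  wres (wres [:: y] [:: x]) (wres [:: y] w).
Proof.
elim: w x y => [|z w IH] x y; first by rewrite !wres_nil.
rewrite /= r_cyc; congr (_ :: _).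
rewrite (r_cyc x z y) (r_cyc y z x).
exact: (IH (r z x) (r z y)).
Qed.

Lemma wres_cyc2 x v w :
  wres (wres [:: x] v) (wres [:: x] w) = wres (wres v [:: x]) (wres v w).
Proof.
elim: v x w => [|y v IH] x w //=.
have := wres_cyc1 x y w => /= ->.
exact: (IH (r y x) (lres y w)).
Qed.

Lemma wres_cyc u v w : wres (wres u v) (wres u w) = wres (wres v u) (wres v w).
Proof.
elim: u v w => [|x u IH] v w; first by rewrite wres_nil.
rewrite /= IH wres_cons_r wres_cat_l.
by have := wres_cyc2 x v w => /= <-.
Qed.

Lemma lres1 w : lres e w = w.
Proof. by elim: w => //= y w IH; rewrite r1x rx1 IH. Qed.

Lemma wres_trivial t w : trivial_word t -> wres t w = w.
Proof. by elim: t => //= x t IH /andP[/eqP-> /IH]; rewrite lres1. Qed.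

Lemma trivial_wres u t : trivial_word t -> trivial_word (wres u t).
Proof.
elim: u t => //= x u IH t Tt; apply: IH.
elim: t x Tt => //= y t IHt x /andP[/eqP-> Tt].
by rewrite rx1 eqxx r1x IHt.
Qed.

Lemma trivial_word_cat u v :
  trivial_word (u ++ v) = trivial_word u && trivial_word v.
Proof. exact: all_cat. Qed.

Lemma wresxx u : trivial_word (wres u u).
Proof.
elim: u => //= x u IH; rewrite rxx lres1.
rewrite -cat1s wres_cat_r trivial_word_cat trivial_wres /= ?eqxx //.
by rewrite lres1.
Qed.

(** Divisibility with the order of a negative cone: by [wleP] below, u is under v when u is a right
    multiple of v. *)
Definition wle u v := trivial_word (wres u v).

Lemma wle_trans v u w : wle u v -> wle v w -> wle u w.
Proof.
rewrite /wle => uv vw; have := wres_cyc u v w.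
by rewrite (wres_trivial _ uv) => ->; rewrite trivial_wres.
Qed.

Lemma wle_cat2l a u v : wle (a ++ u) (a ++ v) = wle u v.
Proof.
rewrite /wle wres_cat_l wres_cat_r wres_cat_r trivial_word_cat.
rewrite trivial_wres ?wresxx //=.
by rewrite !(wres_trivial _ (wresxx a)).
Qed.

Definition wequiv u v := wle u v && wle v u.

Lemma wle_cat2r u v a : wequiv u v -> wle (u ++ a) (v ++ a).
Proof.
case/andP=> uv vu; rewrite /wle wres_cat_l !wres_cat_r trivial_word_cat.
rewrite trivial_wres //=.
by rewrite (wres_trivial _ uv) (wres_trivial _ vu) wresxx.
Qed.

Lemma wequiv_sym u v : wequiv u v = wequiv v u.
Proof. exact: andbC. Qed.

Lemma wequiv_trans v u w : wequiv u v -> wequiv v w -> wequiv u w.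
Proof.
by case/andP=> uv vu /andP[vw wv]; rewrite /wequiv (wle_trans uv) ?(wle_trans wv).
Qed.

Lemma wequiv_cat u u' v v' : wequiv u u' -> wequiv v v' -> wequiv (u ++ v) (u' ++ v').
Proof.
move=> uu' vv'; apply: (@wequiv_trans (u' ++ v)).
  by rewrite /wequiv !wle_cat2r // wequiv_sym.
by rewrite /wequiv !wle_cat2l.
Qed.

Variable E : M -> M -> M -> Prop.
Hypothesis EP : forall a b c, E a b c <-> r c a = e /\ r a c = b.
Hypothesis r_meet : forall x y, exists m,
  [/\ r m x = e, r m y = e, r x m = r x y & r y m = r y x].

Local Notation "u =w v" := (weq e E u v) (at level 70).

Lemma weq_wequiv u v : u =w v -> wequiv u v.
Proof.
elim=> {u v} [u|u v _|v u w _ uv _|u u' v v' _ uu' _|| a b c /EP[ca <-]].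
- by rewrite /wequiv /wle !wresxx.
- by rewrite wequiv_sym.
- exact: wequiv_trans.
- exact: wequiv_cat.
- by rewrite /wequiv /wle /= eqxx.
- by rewrite /wequiv /wle /= ca !rxx !eqxx.
Qed.

(** Both words equal the single letter m of [r_meet], which acts as the meet of x and y. *)
Lemma weq_lcm_letter x y : [:: x; r x y] =w [:: y; r y x].
Proof.
have [m [mx my <- <-]] := r_meet x y.
by apply: (@weq_trans _ _ _ [:: m]); [|apply: weq_sym];
  apply: weq_rule; apply/EP.
Qed.

Lemma weq_lcm u v : u ++ wres u v =w v ++ wres v u.
Proof.
elim: u v => [|x u IH] v; first by rewrite wres_nil cats0; apply: weq_refl.
rewrite /= wres_cons_r.
apply: (@weq_trans _ _ _ (x :: lres x v ++ wres (lres x v) u)).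
  exact: (weq_cat2l [:: x]).
rewrite catA -cat_cons; apply: weq_cat2r.
elim: v x {u IH} => [|y v IHv] x /=; first exact: weq_refl.
apply: (@weq_trans _ _ _ ([:: y; r y x] ++ lres (r y x) v)).
  by rewrite -[_ :: _]/([:: _; _] ++ _); apply/weq_cat2r/weq_lcm_letter.
exact: (weq_cat2l [:: y]).
Qed.

Lemma trivial_weq t : trivial_word t -> t =w [::].
Proof.
elim: t => [_|x t IH /= /andP[/eqP-> Tt]]; first exact: weq_refl.
apply: (@weq_trans _ _ _ ([:: e] ++ [::])); first exact/(weq_cat2l [:: e])/IH.
exact: weq_one.
Qed.

Lemma wle_weq u v : wle u v -> u =w v ++ wres v u.
Proof.
move=> uv; apply: weq_trans (weq_lcm u v).
by apply: weq_sym; rewrite -[X in _ =w X]cats0; apply/weq_cat2l/trivial_weq.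
Qed.

Lemma wequiv_weq u v : wequiv u v -> u =w v.
Proof.
case/andP=> /wle_weq uv /trivial_weq vu; apply: weq_trans uv _.
by rewrite -[X in _ =w X]cats0; apply: weq_cat2l.
Qed.

(** The presentation shows the left-right symmetry of the congruence; residuals decide it and give
    left cancellation. Both views are needed. *)
Lemma weqP u v : u =w v <-> wequiv u v.
Proof. by split; [apply: weq_wequiv|apply: wequiv_weq]. Qed.

Lemma wle_cat_l v z : wle (v ++ z) v.
Proof. by rewrite /wle wres_cat_l trivial_wres // wresxx. Qed.

Lemma wleP u v : wle u v <-> exists z, u =w v ++ z.
Proof.
split=> [/wle_weq uv|[z /weqP/andP[uvz _]]]; first by exists (wres v u).
exact: wle_trans uvz (wle_cat_l _ _).
Qed.

Lemma weq_cancel_l a u v : a ++ u =w a ++ v -> u =w v.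
Proof. by move=> /weqP; rewrite /wequiv !wle_cat2l => /weqP. Qed.

(** The residual x\(u (u\v)) splits into x\u and (u\x)\(u\v); by the cyclic law the latter is
    (x\u)\(x\v), a residual of a trivial word. *)
Lemma weq_lcm_least u v x : (exists z, x =w u ++ z) -> (exists z, x =w v ++ z) ->
  exists z, x =w (u ++ wres u v) ++ z.
Proof.
move=> /wleP xu /wleP xv; apply/wleP.
move: xu xv; rewrite /wle wres_cat_r trivial_word_cat wres_cyc => -> xv.
by rewrite trivial_wres.
Qed.

Lemma weq_cat_nil u v : u ++ v =w [::] -> u =w [::].
Proof.
move=> /weqP/andP[_ uv]; apply/weqP; apply/andP; split.
  by rewrite /wle wres_nil.
exact: wle_trans uv (wle_cat_l _ _).
Qed.

Lemma weq_letter_nil a : [:: a] =w [::] -> a = e.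
Proof. by move=> /weqP/andP[_]; rewrite /wle /= andbT => /eqP. Qed.

(** By computation (a w)\b is w\(a\b), so [wleP] sees the same divisibility on both sides. *)
Lemma weq_letter_res a b w :
  (exists z, a :: w =w b :: z) <-> (exists z, w =w r a b :: z).
Proof.
exact: iff_trans (iff_sym (wleP (a :: w) [:: b])) (wleP w [:: r a b]).
Qed.

End Reversing.

(** * Groups of fractions of cones *)

(** These are properties of the negative cone of an l-group, written without inverses: [cone_moveR]
    and [cone_moveL] say aP = Pa, and the least common right multiple in [cone_lcm] is the meet. *)
HB.mixin Record Monoid_isCone P of Monoid P := {
  cone_cancel_l : forall a b c : P, a * b = a * c -> b = c;
  cone_cancel_r : forall a b c : P, b * a = c * a -> b = c;
  cone_moveR : forall a b : P, exists c, a * b = b * c;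
  cone_moveL : forall a b : P, exists c, a * b = c * a;
  cone_conical : forall a b : P, a * b = 1 -> a = 1;
  cone_lcm : forall a b : P, exists x y,
    a * x = b * y /\ forall u v, a * u = b * v -> exists w, u = x * w
}.

#[short(type="coneType")]
HB.structure Definition Cone := { P of Monoid P & Monoid_isCone P }.

Section Fractions.
Variable P : coneType.
Implicit Types (a b c x y : P) (u v w : P * P).

(** The conjugate c^-1 a c, available in P before there are inverses. *)
Definition cone_conj a c : P := projT1 (cid (cone_moveR a c)).

Lemma cone_conjP a c : a * c = c * cone_conj a c.
Proof. exact: projT2 (cid (cone_moveR a c)). Qed.

Lemma cone_conj_eq a c x : a * c = c * x -> cone_conj a c = x.
Proof. by rewrite cone_conjP => /cone_cancel_l ->. Qed.

Lemma cone_conjM a b c : cone_conj (a * b) c = cone_conj a c * cone_conj b c.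
Proof.
by apply: cone_conj_eq; rewrite -mulgA (cone_conjP b) mulgA (cone_conjP a) -mulgA.
Qed.

Lemma cone_conjJ a b c : cone_conj a (b * c) = cone_conj (cone_conj a b) c.
Proof.
by apply: cone_conj_eq; rewrite mulgA (cone_conjP a) -!mulgA -cone_conjP.
Qed.

Lemma cone_conjg1 a : cone_conj a 1 = a.
Proof. by apply: cone_conj_eq; rewrite mulg1 mul1g. Qed.

Lemma cone_conj1g a : cone_conj 1 a = 1.
Proof. by apply: cone_conj_eq; rewrite mulg1 mul1g. Qed.

Lemma cone_conjgg a : cone_conj a a = a.
Proof. exact: cone_conj_eq. Qed.

(* The pair [(a, b)] stands for the fraction [a * b^-1]. *)
Definition frac_eq u v : bool :=
  `[< exists x y, u.1 * x = v.1 * y /\ u.2 * x = v.2 * y >].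

Lemma frac_eq_refl : reflexive frac_eq.
Proof. by move=> u; apply/asboolP; exists 1, 1. Qed.

Lemma frac_eq_sym : symmetric frac_eq.
Proof.
by move=> u v; apply/asboolP/asboolP => -[x [y [e1 e2]]]; exists y, x.
Qed.

Lemma frac_eq_trans : transitive frac_eq.
Proof.
move=> v u w /asboolP[x [y [e1 e2]]] /asboolP[z [t [f1 f2]]].
(* Ore condition: a common right multiple of y and z lets the two expansions of v be matched. *)
have [p [q [pq _]]] := cone_lcm y z.
apply/asboolP; exists (x * p), (t * q).
by rewrite !mulgA e1 e2 -f1 -f2 -!mulgA pq.
Qed.

Canonical frac_equiv := EquivRel frac_eq frac_eq_refl frac_eq_sym frac_eq_trans.

Definition fractions := {eq_quot frac_equiv}.

HB.instance Definition _ := Choice.on fractions.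
HB.instance Definition _ := EqQuotient.on fractions.

Definition frac u : fractions := \pi u.

Lemma fracP u v : (frac u = frac v) <-> frac_eq u v.
Proof. by split=> [/eqmodP|h]; [|apply/eqmodP]. Qed.

Lemma fracW (Q : fractions -> Prop) : (forall a b, Q (frac (a, b))) -> forall g, Q g.
Proof. by move=> h g; rewrite -(reprK g); case: (repr g) => a b; apply: h. Qed.

Lemma frac_expand a b x : frac (a * x, b * x) = frac (a, b).
Proof. by apply/fracP/asboolP; exists 1, x; rewrite /= !mulg1. Qed.

(** From a b^-1 c d^-1 = a c (d (c^-1 b c))^-1. *)
Definition pair_mul u v : P * P := (u.1 * v.1, v.2 * cone_conj u.2 v.1).

Definition frac_mul (g h : fractions) : fractions :=
  frac (pair_mul (repr g) (repr h)).

(** Equal fractions have a common expansion, so it suffices that expanding a factor by x expands the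
    product: by a conjugate of x for the left factor, by x itself for the right one. *)
Lemma frac_mulE u v : frac_mul (frac u) (frac v) = frac (pair_mul u v).
Proof.
have Hl u' v' w : frac u' = frac v' -> frac (pair_mul u' w) = frac (pair_mul v' w).
  suff Hx a b x : frac (pair_mul (a * x, b * x) w) = frac (pair_mul (a, b) w).
    case: u' v' => [a b] [c d] /fracP/asboolP[x [y [/= e1 e2]]].
    by rewrite -(Hx a b x) -(Hx c d y) e1 e2.
  rewrite /pair_mul /= cone_conjM (mulgA w.2) -(mulgA a) (cone_conjP x) (mulgA a).
  exact: frac_expand.
have Hr u' v' w : frac u' = frac v' -> frac (pair_mul w u') = frac (pair_mul w v').
  suff Hx a b x : frac (pair_mul w (a * x, b * x)) = frac (pair_mul w (a, b)).
    case: u' v' => [a b] [c d] /fracP/asboolP[x [y [/= e1 e2]]].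
    by rewrite -(Hx a b x) -(Hx c d y) e1 e2.
  rewrite /pair_mul /= (mulgA w.1) cone_conjJ -(mulgA b) -cone_conjP (mulgA b).
  exact: frac_expand.
have fracK u' : frac (repr (frac u')) = frac u' by rewrite /frac reprK.
exact: etrans (Hl _ _ _ (fracK u)) (Hr _ _ _ (fracK v)).
Qed.

Definition frac_one : fractions := frac (1, 1).

Definition frac_inv (g : fractions) : fractions :=
  frac ((repr g).2, (repr g).1).

Lemma frac_invE a b : frac_inv (frac (a, b)) = frac (b, a).
Proof.
have /fracP/asboolP[x [y [e1 e2]]] : frac (repr (frac (a, b))) = frac (a, b).
  by rewrite /frac reprK.
by apply/fracP/asboolP; exists x, y.
Qed.

Lemma frac_mulA : associative frac_mul.
Proof.
elim/fracW=> a b; elim/fracW=> c d; elim/fracW=> f g.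
rewrite !frac_mulE /pair_mul /= cone_conjM cone_conjJ !mulgA; congr (frac (_, _)).
Qed.

Lemma frac_mul1 : left_id frac_one frac_mul.
Proof.
by elim/fracW=> a b; rewrite frac_mulE /pair_mul /= cone_conj1g mul1g mulg1.
Qed.

Lemma frac_mulr1 : right_id frac_one frac_mul.
Proof.
by elim/fracW=> a b; rewrite frac_mulE /pair_mul /= cone_conjg1 mul1g mulg1.
Qed.

Lemma frac_mulV : left_inverse frac_one frac_inv frac_mul.
Proof.
elim/fracW=> a b; rewrite frac_invE frac_mulE /pair_mul /= cone_conjgg.
by rewrite -{1}(mul1g (b * a)) -{2}(mul1g (b * a)) frac_expand.
Qed.

Lemma frac_mulrV : right_inverse frac_one frac_inv frac_mul.
Proof.
elim/fracW=> a b; rewrite frac_invE frac_mulE /pair_mul /= cone_conjgg.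
by rewrite -{1}(mul1g (a * b)) -{2}(mul1g (a * b)) frac_expand.
Qed.

HB.instance Definition _ := isGroup.Build fractions
  frac_mulA frac_mul1 frac_mulr1 frac_mulV frac_mulrV.

Definition cone_inj a : fractions := frac (a, 1).

Lemma cone_inj1 : cone_inj 1 = 1. Proof. by []. Qed.

Lemma cone_injM a b : cone_inj (a * b) = cone_inj a * cone_inj b.
Proof.
by rewrite [RHS]frac_mulE /pair_mul /= cone_conj1g mulg1.
Qed.

Lemma cone_inj_inj : injective cone_inj.
Proof.
move=> a b /fracP/asboolP[x [y [/= e1]]]; rewrite !mul1g => xy.
by apply: (@cone_cancel_r _ x); rewrite e1 xy.
Qed.

Lemma fracE a b : frac (a, b) = cone_inj a * (cone_inj b)^-1.
Proof.
rewrite [(cone_inj b)^-1]frac_invE [RHS]frac_mulE /pair_mul /=.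
by rewrite cone_conjg1 !mulg1.
Qed.

Lemma fractionsP (g : fractions) : exists a b, g = cone_inj a * (cone_inj b)^-1.
Proof. by elim/fracW: g => a b; exists a, b; rewrite fracE. Qed.

Definition frac_le (g h : fractions) : bool :=
  `[< exists p, g = h * cone_inj p >].

Lemma frac_le_refl : reflexive frac_le.
Proof. by move=> g; apply/asboolP; exists 1; rewrite cone_inj1 mulg1. Qed.

Lemma frac_le_trans : transitive frac_le.
Proof.
move=> h g k /asboolP[p ->] /asboolP[q ->]; apply/asboolP.
by exists (q * p); rewrite cone_injM mulgA.
Qed.

Lemma frac_le_anti : antisymmetric frac_le.
Proof.
move=> g h /andP[/asboolP[p gE] /asboolP[q hE]].
have /cone_conical q1 : q * p = 1.
  apply: cone_inj_inj; apply: (@mulgI _ g).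
  by rewrite cone_injM cone_inj1 mulg1 mulgA -hE -gE.
by rewrite hE q1 cone_inj1 mulg1.
Qed.

Fact fractions_display : Order.disp_t. Proof. exact: Order.Disp tt tt. Qed.

HB.instance Definition _ := Order.Le_isPOrder.Build fractions_display fractions
  frac_le_refl frac_le_anti frac_le_trans.

Lemma frac_leP (g h : fractions) : reflect (exists p, g = h * cone_inj p) (g <= h).
Proof. exact: asboolP. Qed.

Lemma frac_le_mul2l (k g h : fractions) : g <= h -> k * g <= k * h.
Proof.
by move=> /frac_leP[p ->]; apply/frac_leP; exists p; rewrite mulgA.
Qed.

(** The image of P is normal in the group: numerators conjugate by [cone_moveR], denominators by
    [cone_moveL]. Compatibility of the order with right multiplication rests on this. *)
Lemma cone_inj_conj a (g : fractions) : exists b, cone_inj a ^ g = cone_inj b.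
Proof.
have [c [d ->]] := fractionsP g; rewrite conjgM.
have -> : cone_inj a ^ cone_inj c = cone_inj (cone_conj a c).
  by rewrite conjgE -cone_injM cone_conjP cone_injM mulKg.
have [x xE] := cone_moveL d (cone_conj a c).
by exists x; rewrite conjgE invgK mulgA -cone_injM xE cone_injM mulgK.
Qed.

Lemma frac_le_mul2r (k g h : fractions) : g <= h -> g * k <= h * k.
Proof.
move=> /frac_leP[p ->]; apply/frac_leP.
have [q qE] := cone_inj_conj p k; exists q.
by rewrite -qE conjgE !mulgA mulgK.
Qed.

Lemma frac_leV (g h : fractions) : g <= h -> h^-1 <= g^-1.
Proof.
move=> /(@frac_le_mul2l g^-1) /(@frac_le_mul2r h^-1).
by rewrite mulVg mul1g mulgK.
Qed.

(** With h^-1 g = a b^-1, multiplying by h on the left and by b^-1 on the right carries a to g and b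
    to h. It therefore carries the least common right multiple a x = b y, which is the meet of a and
    b, to the meet of g and h. *)
Lemma frac_meet_ex (g h : fractions) :
  exists m, forall f, (f <= m) = (f <= g) && (f <= h).
Proof.
have [a [b hg]] := fractionsP (h^-1 * g).
have [x [y [axby lcm_min]]] := cone_lcm a b.
have gE : g = h * (cone_inj a * (cone_inj b)^-1) by rewrite -hg mulVKg.
exists (h * (cone_inj (a * x) * (cone_inj b)^-1)) => f.
apply/idP/andP => [fm|[fg fh]].
  split; apply: le_trans fm _; rewrite ?gE.
    apply: frac_le_mul2l; apply: frac_le_mul2r; apply/frac_leP.
    by exists x; rewrite cone_injM.
  rewrite -[leRHS]mulg1; apply: frac_le_mul2l.
  rewrite axby -(mulgV (cone_inj b)); apply: frac_le_mul2r; apply/frac_leP.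
  by exists y; rewrite cone_injM.
have /frac_leP[u uE] : h^-1 * f * cone_inj b <= cone_inj a.
  rewrite -(mulgVK (cone_inj b) (cone_inj a)) -hg.
  by apply: frac_le_mul2r; apply: frac_le_mul2l.
have /frac_leP[v vE] : h^-1 * f * cone_inj b <= cone_inj b.
  rewrite -[leRHS]mul1g -(mulVg h).
  by apply: frac_le_mul2r; apply: frac_le_mul2l.
have [w uw] : exists w : P, u = x * w.
  apply: (lcm_min u v); apply: cone_inj_inj.
  by rewrite !cone_injM -uE -vE.
rewrite -(mulVKg h f); apply: frac_le_mul2l.
rewrite -(mulgK (cone_inj b) (h^-1 * f)); apply: frac_le_mul2r.
by apply/frac_leP; exists w; rewrite uE uw !cone_injM mulgA.
Qed.

Definition frac_meet g h : fractions := projT1 (cid (frac_meet_ex g h)).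

Lemma frac_meetP f g h : (f <= frac_meet g h) = (f <= g) && (f <= h).
Proof. exact: (projT2 (cid (frac_meet_ex g h)) f). Qed.

Definition frac_join (g h : fractions) : fractions := (frac_meet g^-1 h^-1)^-1.

Lemma frac_leVE (g h : fractions) : (g^-1 <= h^-1) = (h <= g).
Proof. by apply/idP/idP => /frac_leV; rewrite ?invgK. Qed.

Lemma frac_joinP g h f : (frac_join g h <= f) = (g <= f) && (h <= f).
Proof. by rewrite -frac_leVE invgK frac_meetP !frac_leVE. Qed.

HB.instance Definition _ := Order.POrder_MeetJoin_isLattice.Build
  fractions_display fractions frac_meetP frac_joinP.

HB.instance Definition _ := isLatticeOrdered.Build fractions_display fractions
  frac_le_mul2l frac_le_mul2r.

End Fractions.

(** * Integral GMV-algebras *)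

Lemma le_eq d (T : porderType d) (x y : T) :
  (forall z, (z <= x) = (z <= y)) -> x = y.
Proof. by move=> h; apply: le_anti; rewrite h lexx -h lexx. Qed.

Section ResiduatedLatticeTheory.
Variables (d : Order.disp_t) (L : residuatedLatticeType d).
Implicit Types x y z : L.

Lemma ldivK x y : x * ldiv x y <= y. Proof. by rewrite ldivP. Qed.

Lemma rdivK x y : rdiv x y * y <= x. Proof. by rewrite rdivP. Qed.

Lemma le_ldivM x y : y <= ldiv x (x * y). Proof. by rewrite -ldivP. Qed.

Lemma le_rdivM x y : x <= rdiv (x * y) y. Proof. by rewrite -rdivP. Qed.

Lemma le_mul2l z x y : x <= y -> z * x <= z * y.
Proof. by move=> xy; rewrite ldivP (le_trans xy) ?le_ldivM. Qed.

Lemma le_mul2r z x y : x <= y -> x * z <= y * z.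
Proof. by move=> xy; rewrite rdivP (le_trans xy) ?le_rdivM. Qed.

Lemma le_mul x x' y y' : x <= x' -> y <= y' -> x * y <= x' * y'.
Proof. by move=> xx' yy'; apply: le_trans (le_mul2r _ xx') (le_mul2l _ yy'). Qed.

Lemma le_ldiv2l z x y : x <= y -> ldiv z x <= ldiv z y.
Proof. by move=> xy; rewrite -ldivP (le_trans (ldivK _ _)). Qed.

Lemma le_ldiv2r z x y : x <= y -> ldiv y z <= ldiv x z.
Proof. by move=> xy; rewrite -ldivP (le_trans (le_mul2r _ xy)) ?ldivK. Qed.

Lemma le_rdiv2r z x y : x <= y -> rdiv x z <= rdiv y z.
Proof. by move=> xy; rewrite -rdivP (le_trans (rdivK _ _)). Qed.

Lemma le_rdiv2l z x y : x <= y -> rdiv z y <= rdiv z x.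
Proof. by move=> xy; rewrite -rdivP (le_trans (le_mul2l _ xy)) ?rdivK. Qed.

Lemma ldiv_mul x y z : ldiv (x * y) z = ldiv y (ldiv x z).
Proof. by apply: le_eq => t; rewrite -!ldivP mulgA. Qed.

Lemma rdiv_mul x y z : rdiv z (x * y) = rdiv (rdiv z y) x.
Proof. by apply: le_eq => t; rewrite -!rdivP mulgA. Qed.

Lemma ldiv_rdiv x y z : ldiv x (rdiv y z) = rdiv (ldiv x y) z.
Proof. by apply: le_eq => t; rewrite -ldivP -!rdivP -ldivP mulgA. Qed.

Lemma ldiv1 x : ldiv 1 x = x.
Proof. by apply: le_eq => t; rewrite -ldivP mul1g. Qed.

Lemma rdiv1 x : rdiv x 1 = x.
Proof. by apply: le_eq => t; rewrite -rdivP mulg1. Qed.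

Lemma ldivI x y z : ldiv x (y `&` z) = ldiv x y `&` ldiv x z.
Proof. by apply: le_eq => t; rewrite lexI -!ldivP lexI. Qed.

Lemma le1_ldiv x y : (1 <= ldiv x y) = (x <= y).
Proof. by rewrite -ldivP mulg1. Qed.

Lemma le1_rdiv x y : (1 <= rdiv y x) = (x <= y).
Proof. by rewrite -rdivP mul1g. Qed.

End ResiduatedLatticeTheory.

Section GMVTheory.
Variables (d : Order.disp_t) (L : gmvAlgebraType d).
Implicit Types x y z : L.

(** Put w = (x\z) [&] 1. The first GMV identity gives x = z/w, hence u = y\x = (y\z)/w = u/w. The
    second one then gives 1 <= (u [&] 1)\u = ((u/w) [&] 1)\u = u [|] w <= x\z, that is x <= z. *)
Lemma gmv_mul_ldiv x y : x <= y -> y * ldiv y x = x.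
Proof.
move=> xy; set u := ldiv y x; set z := y * u.
have zx : z <= x by apply: ldivK.
have uE : u = ldiv y z.
  by apply: le_anti; rewrite le_ldivM le_ldiv2l.
have uz : u <= ldiv x z by rewrite uE le_ldiv2r.
have uw : u = rdiv u (ldiv x z `&` 1).
  by rewrite {2}uE -ldiv_rdiv rdivE (join_idPr zx).
apply: le_anti; rewrite zx -le1_ldiv.
have : 1 <= ldiv (u `&` 1) u by rewrite le1_ldiv leIl.
by rewrite {1}uw ldivE => /le_trans; apply; rewrite leUx uz leIl.
Qed.

Lemma gmv_mul_rdiv x y : x <= y -> rdiv x y * y = x.
Proof.
move=> xy; set u := rdiv x y; set z := u * y.
have zx : z <= x by apply: rdivK.
have uE : u = rdiv z y.
  by apply: le_anti; rewrite le_rdivM le_rdiv2r.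
have uz : u <= rdiv z x by rewrite uE le_rdiv2l.
have uw : u = ldiv (rdiv z x `&` 1) u.
  by rewrite {2}uE ldiv_rdiv ldivE (join_idPr zx).
apply: le_anti; rewrite zx -le1_rdiv.
have : 1 <= rdiv u (u `&` 1) by rewrite le1_rdiv leIl.
by rewrite {2}uw rdivE => /le_trans; apply; rewrite leUx uz leIl.
Qed.

End GMVTheory.

HB.mixin Record isIntegral d T of ResiduatedLattice d T := {
  lex1g : forall x : T, x <= 1
}.

#[short(type="integralGMVType")]
HB.structure Definition IntegralGMV d :=
  { T of GMVAlgebra d T & isIntegral d T }.

Section IntegralGMVTheory.
Variables (d : Order.disp_t) (L : integralGMVType d).
Implicit Types x y z : L.

Lemma ldiv_eq1 x y : (ldiv x y == 1) = (x <= y).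
Proof. by rewrite eq_le lex1g le1_ldiv. Qed.

Lemma rdiv_eq1 x y : (rdiv y x == 1) = (x <= y).
Proof. by rewrite eq_le lex1g le1_rdiv. Qed.

Lemma le_mulgl x y : x * y <= x.
Proof. by rewrite -[leRHS]mulg1 le_mul2l ?lex1g. Qed.

Lemma le_mulgr x y : x * y <= y.
Proof. by rewrite -[leRHS]mul1g le_mul2r ?lex1g. Qed.

Lemma gmv_rdiv_ldiv x y : rdiv x (ldiv y x) = x `|` y.
Proof. by rewrite -rdivE (meet_idPl (lex1g _)). Qed.

Lemma gmv_ldiv_rdiv x y : ldiv (rdiv x y) x = x `|` y.
Proof. by rewrite -ldivE (meet_idPl (lex1g _)). Qed.

Lemma le_ldiv x y : y <= ldiv x y.
Proof. by rewrite -ldivP le_mulgr. Qed.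

Lemma le_rdiv x y : x <= rdiv x y.
Proof. by rewrite -rdivP le_mulgl. Qed.

Lemma ldivxx x : ldiv x x = 1. Proof. by apply/eqP; rewrite ldiv_eq1. Qed.

Lemma rdivxx x : rdiv x x = 1. Proof. by apply/eqP; rewrite rdiv_eq1. Qed.

Lemma ldivx1 x : ldiv x 1 = 1. Proof. by apply/eqP; rewrite ldiv_eq1 lex1g. Qed.

Lemma rdiv1x x : rdiv 1 x = 1. Proof. by apply/eqP; rewrite rdiv_eq1 lex1g. Qed.

Lemma ldiv_meetr x y : ldiv x (x `&` y) = ldiv x y.
Proof. by rewrite ldivI ldivxx (meet_idPr (lex1g _)). Qed.

Lemma rdiv_meetr x y : rdiv (x `&` y) x = rdiv y x.
Proof.
by apply: le_eq => z; rewrite -!rdivP lexI le_mulgr.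
Qed.

Lemma mul_ldiv x y : x * ldiv x y = x `&` y.
Proof. by rewrite -ldiv_meetr gmv_mul_ldiv ?leIl. Qed.

Lemma mul_rdiv x y : rdiv y x * x = x `&` y.
Proof. by rewrite -rdiv_meetr gmv_mul_rdiv ?leIl. Qed.

(* Meant to say that [z] is the product of [x] and [y] in the l-group under   *)
(* construction; the product [x * y] of [L] may be larger.                    *)
Definition factors x y z := z <= x /\ ldiv x z = y.

(** The GMV identities recover x as z/(x\z), and symmetrically. This self-duality makes the
    presentation by [factors] invariant under reversal of words. *)
Lemma factorsE x y z : factors x y z <-> z <= y /\ rdiv z y = x.
Proof.
split=> -[zx <-]; split.
- exact: le_ldiv.
- by rewrite gmv_rdiv_ldiv (join_idPr zx).
- exact: le_rdiv.
- by rewrite gmv_ldiv_rdiv (join_idPr zx).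
Qed.

Lemma factors_ldiv x z : z <= x -> factors x (ldiv x z) z.
Proof. by []. Qed.

Lemma factors_rdiv x z : z <= x -> factors (rdiv z x) x z.
Proof. by move=> zx; apply/factorsE. Qed.

(** Both sides are (x [&] y)\z, because x (x\y) = x [&] y. *)
Lemma ldiv_cyc x y z : ldiv (ldiv x y) (ldiv x z) = ldiv (ldiv y x) (ldiv y z).
Proof. by rewrite -!ldiv_mul !mul_ldiv meetC. Qed.

Lemma rdiv_cyc x y z : rdiv (rdiv z x) (rdiv y x) = rdiv (rdiv z y) (rdiv x y).
Proof. by rewrite -!rdiv_mul !mul_rdiv meetC. Qed.

Definition flip_factors x y z := factors y x z.

Lemma factorsP x y z : factors x y z <-> ldiv z x = 1 /\ ldiv x z = y.
Proof.
split=> -[h <-]; split=> //; first by apply/eqP; rewrite ldiv_eq1.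
by move/eqP: h; rewrite ldiv_eq1.
Qed.

Lemma flip_factorsP x y z :
  flip_factors x y z <-> rdiv x z = 1 /\ rdiv z x = y.
Proof.
split=> [/factorsE|] -[h <-]; first by split=> //; apply/eqP; rewrite rdiv_eq1.
by apply: factors_rdiv; move/eqP: h; rewrite rdiv_eq1.
Qed.

Lemma ldiv_meet_ex x y : exists m,
  [/\ ldiv m x = 1, ldiv m y = 1, ldiv x m = ldiv x y & ldiv y m = ldiv y x].
Proof.
exists (x `&` y); rewrite ldiv_meetr meetC ldiv_meetr; split=> //; apply/eqP;
  by rewrite ldiv_eq1 ?leIl ?leIr.
Qed.

Lemma rdiv_meet_ex x y : exists m,
  [/\ rdiv x m = 1, rdiv y m = 1, rdiv m x = rdiv y x & rdiv m y = rdiv x y].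
Proof.
exists (x `&` y); rewrite rdiv_meetr meetC rdiv_meetr; split=> //; apply/eqP;
  by rewrite rdiv_eq1 ?leIl ?leIr.
Qed.

End IntegralGMVTheory.

(** * The monoid of words over an integral GMV-algebra is a cone *)

Section WordCone.
Variables (d : Order.disp_t) (L : integralGMVType d).
Implicit Types (x y z : L) (u v w : seq L).

Local Notation eqw := (weq 1 (@factors d L)).

Definition word_eq u v : bool := `[< eqw u v >].

Lemma word_eq_refl : reflexive word_eq.
Proof. by move=> u; apply/asboolP/weq_refl. Qed.

Lemma word_eq_sym : symmetric word_eq.
Proof. by move=> u v; apply/asboolP/asboolP; apply: weq_sym. Qed.

Lemma word_eq_trans : transitive word_eq.
Proof.
by move=> v u w /asboolP uv /asboolP vw; apply/asboolP/(weq_trans uv).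
Qed.

Canonical word_equiv := EquivRel word_eq word_eq_refl word_eq_sym word_eq_trans.

Definition word_cone := {eq_quot word_equiv}.

HB.instance Definition _ := Choice.on word_cone.
HB.instance Definition _ := EqQuotient.on word_cone.

Definition wclass u : word_cone := \pi u.

Lemma wclassP u v : wclass u = wclass v <-> eqw u v.
Proof. by split=> [/eqmodP/asboolP|h]; [|apply/eqmodP/asboolP]. Qed.

Lemma wclassW (Q : word_cone -> Prop) : (forall u, Q (wclass u)) -> forall p, Q p.
Proof. by move=> h p; rewrite -(reprK p); apply: h. Qed.

Definition wclass_mul (p q : word_cone) := wclass (repr p ++ repr q).

Lemma wclass_mulE u v : wclass_mul (wclass u) (wclass v) = wclass (u ++ v).
Proof.
by apply/wclassP; apply: weq_cat; apply/wclassP; rewrite /wclass reprK.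
Qed.

Lemma wclass_mulA : associative wclass_mul.
Proof.
by elim/wclassW=> u; elim/wclassW=> v; elim/wclassW=> w; rewrite !wclass_mulE catA.
Qed.

Lemma wclass_mul1 : left_id (wclass [::]) wclass_mul.
Proof. by elim/wclassW=> u; rewrite wclass_mulE. Qed.

Lemma wclass_mulr1 : right_id (wclass [::]) wclass_mul.
Proof. by elim/wclassW=> u; rewrite wclass_mulE cats0. Qed.

HB.instance Definition _ := isMonoid.Build word_cone
  wclass_mulA wclass_mul1 wclass_mulr1.

Definition letter x : word_cone := wclass [:: x].

Lemma wclass_cat u v : wclass (u ++ v) = wclass u * wclass v.
Proof. by rewrite -wclass_mulE. Qed.

Lemma wclass_cons x u : wclass (x :: u) = letter x * wclass u.
Proof. by rewrite -wclass_cat. Qed.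

Lemma word_cone_ind (Q : word_cone -> Prop) :
  Q 1 -> (forall x p, Q p -> Q (letter x * p)) -> forall p, Q p.
Proof.
move=> Q1 QM; elim/wclassW; elim=> [|x u IH]; first exact: Q1.
by rewrite wclass_cons; apply: QM.
Qed.

Lemma letter_factors x y z : factors x y z -> letter x * letter y = letter z.
Proof. by move=> h; rewrite -wclass_cat; apply/wclassP/weq_rule. Qed.

Lemma rev_weq u v : eqw u v <-> weq 1 (@flip_factors d L) (rev u) (rev v).
Proof.
split; first exact: weq_rev.
by rewrite -{2}(revK u) -{2}(revK v); apply: weq_rev.
Qed.

Lemma word_cone_cancel_l (p q r : word_cone) : p * q = p * r -> q = r.
Proof.
elim/wclassW: p => u; elim/wclassW: q => v; elim/wclassW: r => w.
rewrite -!wclass_cat => /wclassP h; apply/wclassP.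
exact: (weq_cancel_l (@ldivxx _ _) (@ldiv1 _ _) (@ldivx1 _ _) (@ldiv_cyc _ _)
  (@factorsP _ _) (@ldiv_meet_ex _ _) h).
Qed.

(** Left cancellation of the reversed words, where reversing is run with the right residual
    [rdiv y x] in place of x\y. *)
Lemma word_cone_cancel_r (p q r : word_cone) : q * p = r * p -> q = r.
Proof.
elim/wclassW: p => u; elim/wclassW: q => v; elim/wclassW: r => w.
rewrite -!wclass_cat => /wclassP/rev_weq; rewrite !rev_cat => h.
apply/wclassP/rev_weq.
exact: (weq_cancel_l (r := fun x y => rdiv y x)
  (@rdivxx _ _) (@rdiv1 _ _) (@rdiv1x _ _) (@rdiv_cyc _ _)
  (@flip_factorsP _ _) (@rdiv_meet_ex _ _) h).
Qed.

(** Write . for the product of words. As y <= n and o <= x, one has y = n . c and o = x . n, so x .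
    y = o . c. Moreover o <= y <= c, and with o' = o/(o/c) this becomes o . c = o' . (o/c) . c = o'
    . o = o' . (o/x) . x. *)
Lemma letter_moveL x y : exists p, letter x * letter y = p * letter x.
Proof.
set o := x * y; set n := ldiv x o; set c := ldiv n y.
have yn : y <= n by apply: le_ldivM.
have oc : o <= c by apply: le_trans (le_mulgr _ _) (le_ldiv _ _).
have ox : o <= x by apply: le_mulgl.
exists (letter (rdiv o (rdiv o c)) * letter (rdiv o x)).
rewrite -mulgA (letter_factors (factors_rdiv ox)).
rewrite -(letter_factors (factors_ldiv yn)) mulgA.
rewrite (letter_factors (factors_ldiv ox)).
rewrite -{1}(letter_factors (factors_rdiv (le_rdiv o c))) -mulgA.
by rewrite (letter_factors (factors_rdiv oc)).
Qed.

Lemma letter_moveR x y : exists p, letter y * letter x = letter x * p.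
Proof.
set o := y * x; set n := rdiv o x; set c := rdiv y n.
have yn : y <= n by apply: le_rdivM.
have oc : o <= c by apply: le_trans (le_mulgl _ _) (le_rdiv _ _).
have ox : o <= x by apply: le_mulgr.
exists (letter (ldiv x o) * letter (ldiv (ldiv c o) o)).
rewrite mulgA (letter_factors (factors_ldiv ox)).
rewrite -(letter_factors (factors_rdiv yn)) -mulgA.
rewrite (letter_factors (factors_rdiv ox)).
rewrite -{1}(letter_factors (factors_ldiv (le_ldiv c o))) mulgA.
by rewrite (letter_factors (factors_ldiv oc)).
Qed.

Lemma word_cone_moveL (p q : word_cone) : exists r, p * q = r * p.
Proof.
elim/word_cone_ind: p q => [|x p IH] q.
  by exists q; rewrite mul1g mulg1.
have [r rE] := IH q; rewrite -mulgA rE mulgA.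
suff [s ->] : exists s, letter x * r = s * letter x by exists s; rewrite mulgA.
elim/word_cone_ind: r {rE} => [|y r [s sE]].
  by exists 1; rewrite mul1g mulg1.
have [t tE] := letter_moveL x y.
by exists (t * s); rewrite mulgA tE -!mulgA sE.
Qed.

Lemma word_cone_moveR (q p : word_cone) : exists r, q * p = p * r.
Proof.
elim/word_cone_ind: p q => [|x p IH] q.
  by exists q; rewrite mul1g mulg1.
suff [s sE] : exists s, q * letter x = letter x * s.
  by have [r rE] := IH s; exists r; rewrite mulgA sE -!mulgA rE.
elim/word_cone_ind: q => [|y r [s sE]].
  by exists 1; rewrite mul1g mulg1.
have [t tE] := letter_moveR x y.
by exists (t * s); rewrite -mulgA sE !mulgA tE.
Qed.

Lemma word_cone_conical (p q : word_cone) : p * q = 1 -> p = 1.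
Proof.
elim/wclassW: p => u; elim/wclassW: q => v.
rewrite -!wclass_cat => /wclassP h; apply/wclassP.
exact: (weq_cat_nil (@ldivxx _ _) (@ldiv1 _ _) (@ldivx1 _ _) (@ldiv_cyc _ _)
  (@factorsP _ _) (@ldiv_meet_ex _ _) h).
Qed.

Lemma word_cone_lcm (p q : word_cone) : exists r s,
  p * r = q * s /\ forall t t', p * t = q * t' -> exists p', t = r * p'.
Proof.
elim/wclassW: p => u; elim/wclassW: q => v.
exists (wclass (wres (@ldiv d L) u v)), (wclass (wres (@ldiv d L) v u)).
rewrite -!wclass_cat; split.
  exact/wclassP/(weq_lcm (@factorsP _ _) (@ldiv_meet_ex _ _)).
elim/wclassW=> t; elim/wclassW=> t'; rewrite -!wclass_cat => /wclassP tt'.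
have [||w /wclassP] := weq_lcm_least (@ldivxx _ _) (@ldiv1 _ _) (@ldivx1 _ _)
  (@ldiv_cyc _ _) (@factorsP _ _) (@ldiv_meet_ex _ _) (u := u) (v := v) (x := u ++ t).
- by exists t; apply: weq_refl.
- by exists t'.
rewrite -catA [LHS]wclass_cat [RHS]wclass_cat => /word_cone_cancel_l ->.
by exists (wclass w); rewrite wclass_cat.
Qed.

HB.instance Definition _ := Monoid_isCone.Build word_cone
  word_cone_cancel_l word_cone_cancel_r word_cone_moveR word_cone_moveL
  word_cone_conical word_cone_lcm.

Lemma letter_eq1 x : letter x = 1 -> x = 1.
Proof.
move=> /wclassP.
exact: (weq_letter_nil (@ldivxx _ _) (@ldiv1 _ _) (@ldivx1 _ _) (@ldiv_cyc _ _)
  (@factorsP _ _) (@ldiv_meet_ex _ _)).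
Qed.

Lemma letter_res x y (p : word_cone) :
  (exists q, letter x * p = letter y * q) <-> (exists q, p = letter (ldiv x y) * q).
Proof.
elim/wclassW: p => w.
have H := weq_letter_res (@ldivxx _ _) (@ldiv1 _ _) (@ldivx1 _ _) (@ldiv_cyc _ _)
  (@factorsP _ _) (@ldiv_meet_ex _ _) x y w.
split=> -[]; elim/wclassW=> z; rewrite -!wclass_cons => /wclassP h.
  have [v /wclassP] := H.1 (ex_intro _ z h).
  by rewrite wclass_cons => ->; exists (wclass v).
have [v /wclassP] := H.2 (ex_intro _ z h).
by rewrite !wclass_cons => ->; exists (wclass v).
Qed.

End WordCone.

(** * Filters and convex l-subgroups *)

(** The maps act on arbitrary subsets instead of subtypes, which keeps composition simple; they are
    required to be mutually inverse on members of the families. *)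
Record family_iso T (C : set T -> Prop) T' (C' : set T' -> Prop) : Type := FamilyIso {
  fam_to : set T -> set T';
  fam_of : set T' -> set T;
  fam_toP : forall H, C H -> C' (fam_to H);
  fam_ofP : forall K, C' K -> C (fam_of K);
  fam_toK : forall H, C H -> fam_of (fam_to H) = H;
  fam_ofK : forall K, C' K -> fam_to (fam_of K) = K;
  fam_to_sub : forall H H', (H `<=` H' -> fam_to H `<=` fam_to H')%classic;
  fam_of_sub : forall K K', (K `<=` K' -> fam_of K `<=` fam_of K')%classic
}.

Lemma family_iso_trans T (C : set T -> Prop) T' (C' : set T' -> Prop)
    T'' (C'' : set T'' -> Prop) :
  family_iso C C' -> family_iso C' C'' -> family_iso C C''.
Proof.
move=> f g; exists (fun H => fam_to g (fam_to f H)) (fun K => fam_of f (fam_of g K)).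
- by move=> H CH; do 2!apply: fam_toP.
- by move=> K CK; do 2!apply: fam_ofP.
- by move=> H CH; rewrite fam_toK ?fam_toK //; apply: fam_toP.
- by move=> H CH; rewrite fam_ofK ?fam_ofK //; apply: fam_ofP.
- by move=> H H' HH'; do 2!apply: fam_to_sub.
- by move=> H H' HH'; do 2!apply: fam_of_sub.
Qed.

Lemma order_iso_lattice_isomorphic d (T : latticeType d) d' (T' : latticeType d')
    (f : T -> T') (g : T' -> T) :
  cancel f g -> cancel g f -> {homo f : x y / x <= y} -> {homo g : x y / x <= y} ->
  lattice_isomorphic T T'.
Proof.
move=> fK gK fh gh.
have adj x y : (y <= f x) = (g y <= x).
  by apply/idP/idP => [/gh|/fh]; rewrite ?fK ?gK.
have adj' x y : (f x <= y) = (x <= g y).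
  by apply/idP/idP => [/gh|/fh]; rewrite ?fK ?gK.
have fI : {morph f : x y / x `&` y}.
  by move=> x y; apply: le_eq => z; rewrite lexI !adj lexI.
have fU : {morph f : x y / x `|` y}.
  move=> x y; apply: le_anti; rewrite leUx !fh ?leUl ?leUr ?andbT //.
  by rewrite adj' leUx -!adj' leUl leUr.
pose m0 := Order.isOrderMorphism.Build d T d' T' f fh.
pose mI := Order.isMeetLatticeMorphism.Build d T d' T' f fI.
pose mU := Order.isJoinLatticeMorphism.Build d T d' T' f fU.
pose F : {lmorphism T -> T'} := HB.pack f m0 mI mU.
by exists F; exists g.
Qed.

Lemma closed_set_isomorphic T (C : closure_system T) T' (C' : closure_system T') :
  family_iso C C' -> lattice_isomorphic (closed_set C) (closed_set C').
Proof.
move=> i.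
have toP (H : closed_set C) : `[< C' (fam_to i (val H)) >].
  by apply/asboolP; apply: fam_toP; apply: closed_setP.
have ofP (K : closed_set C') : `[< C (fam_of i (val K)) >].
  by apply/asboolP; apply: fam_ofP; apply: closed_setP.
pose f (H : closed_set C) : closed_set C' := exist _ (fam_to i (val H)) (toP H).
pose g (K : closed_set C') : closed_set C := exist _ (fam_of i (val K)) (ofP K).
apply: (@order_iso_lattice_isomorphic _ _ _ _ f g).
- by move=> H; apply/val_inj; apply: fam_toK; apply: closed_setP.
- by move=> K; apply/val_inj; apply: fam_ofK; apply: closed_setP.
- move=> H K; rewrite !closed_set_leE => /asboolP HK; apply/asboolP.
  exact: fam_to_sub.
- move=> H K; rewrite !closed_set_leE => /asboolP HK; apply/asboolP.
  exact: fam_of_sub.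
Qed.

Section LGroupTheory.
Variables (d : Order.disp_t) (G : lgroupType d).
Implicit Types x y z : G.

Lemma leg_mul x x' y y' : x <= x' -> y <= y' -> x * y <= x' * y'.
Proof.
by move=> /(leg_mul2r y) xx' /(leg_mul2l x'); apply: le_trans.
Qed.

Lemma leg_mul2lE z x y : (z * x <= z * y) = (x <= y).
Proof.
apply/idP/idP; last exact: leg_mul2l.
by move=> /(leg_mul2l z^-1); rewrite !mulKg.
Qed.

Lemma leg_mul2rE z x y : (x * z <= y * z) = (x <= y).
Proof.
apply/idP/idP; last exact: leg_mul2r.
by move=> /(leg_mul2r z^-1); rewrite !mulgK.
Qed.

Lemma legV x y : (x^-1 <= y^-1) = (y <= x).
Proof.
by rewrite -(leg_mul2lE x x^-1) mulgV -(leg_mul2rE y 1) mul1g mulgVK.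
Qed.

Lemma legJ z x y : x <= y -> x ^ z <= y ^ z.
Proof. by move=> xy; rewrite !conjgE !leg_mul2lE leg_mul2rE. Qed.

Lemma invg_ge1 x : (1 <= x^-1) = (x <= 1).
Proof. by rewrite -{1}invg1 legV. Qed.

Lemma leg_mulI x y z : x * (y `&` z) = x * y `&` x * z.
Proof.
have adj t w : (t <= x * w) = (x^-1 * t <= w).
  by rewrite -(leg_mul2lE x^-1 t) mulKg.
by apply: le_eq => t; rewrite lexI !adj lexI.
Qed.

Lemma lgroup_fraction x : exists u v, [/\ u <= 1, v <= 1 & x = u * v^-1].
Proof.
exists (x `&` 1), (x^-1 `&` 1); rewrite !leIr; split=> //.
(* Amounts to x (x^-1 [&] 1) = x [&] 1. *)
apply: (@mulIg _ (x^-1 `&` 1)); rewrite mulgVK.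
by rewrite leg_mulI mulgV mulg1 meetC.
Qed.

End LGroupTheory.

Section Filters.
Variables (d : Order.disp_t) (L : residuatedLatticeType d).

Definition mfilter (F : set L) : Prop :=
  [/\ F 1, forall x y, F x -> x <= y -> F y & forall x y, F x -> F y -> F (x * y)].

Definition normal_mfilter (F : set L) : Prop :=
  mfilter F /\ forall x y : L, F x -> F (ldiv y (x * y)) /\ F (rdiv (y * x) y).

End Filters.

(** * The enveloping l-group of an integral GMV-algebra, and filters against convex l-subgroups *)

Section Envelope.
Variables (d : Order.disp_t) (L : integralGMVType d).
Implicit Types (x y z : L) (s : seq L).

Definition envelope := fractions (word_cone L).

HB.instance Definition _ := LGroup.on envelope.

Definition env_word s : envelope := cone_inj (wclass s).

Definition env x : envelope := cone_inj (letter x).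

Lemma env_word_cons x s : env_word (x :: s) = env x * env_word s.
Proof. by rewrite /env_word wclass_cons cone_injM. Qed.

Lemma env_word_cat s t : env_word (s ++ t) = env_word s * env_word t.
Proof. by rewrite /env_word wclass_cat cone_injM. Qed.

Lemma env_word_le1 s : env_word s <= 1.
Proof. by apply/frac_leP; exists (wclass s); rewrite mul1g. Qed.

Lemma env_wordP (g : envelope) : g <= 1 -> exists s, g = env_word s.
Proof.
by move=> /frac_leP[p]; rewrite mul1g => ->; elim/wclassW: p => s; exists s.
Qed.

Lemma env_le1 x : env x <= 1.
Proof. exact: env_word_le1. Qed.

Lemma env_factors x y z : factors x y z -> env x * env y = env z.
Proof. by rewrite -cone_injM => /letter_factors ->. Qed.

(** An element g <= 1 is the class of a word, and both inequalities are divisibilities compared by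
    [letter_res]. *)
Lemma env_res x y (g : envelope) : g <= 1 ->
  (env x * g <= env y) = (g <= env (ldiv x y)).
Proof.
move=> /env_wordP[s ->]; apply/frac_leP/frac_leP => -[p].
  rewrite -!cone_injM => /cone_inj_inj h.
  have [q qE] : exists q, wclass s = letter (ldiv x y) * q.
    by apply/letter_res; exists p.
  by exists q; rewrite /env_word qE cone_injM.
rewrite -!cone_injM => /cone_inj_inj h.
have [q qE] : exists q, letter x * wclass s = letter y * q.
  by apply/letter_res; exists p.
by exists q; rewrite -!cone_injM qE.
Qed.

Lemma env_ge1 x : 1 <= env x -> x = 1.
Proof.
move=> x1; apply/letter_eq1/cone_inj_inj; apply: le_anti.
by rewrite [X in _ && X]x1 andbT; apply: env_le1.
Qed.

Lemma env1 : env 1 = 1.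
Proof.
apply: (@mulgI _ (env 1)); rewrite mulg1; apply: env_factors.
by split; rewrite ?ldivxx.
Qed.

Lemma env_leE x y : (env x <= env y) = (x <= y).
Proof.
rewrite -[env x]mulg1 env_res // -ldiv_eq1; apply/idP/eqP => [/env_ge1//|->].
by rewrite env1.
Qed.

Lemma env_mul_le x y : env x * env y <= env (x * y).
Proof. by rewrite env_res ?env_le1 // env_leE le_ldivM. Qed.

(** Residuation peels off one letter at a time, by [env_res] in the envelope and by [ldivP] in L;
    the two products themselves may differ. *)
Lemma env_word_le s x : env_word s <= env x -> foldr *%g 1 s <= x.
Proof.
elim: s x => [|y s IH] x; first by move=> /env_ge1->.
by rewrite env_word_cons env_res ?env_word_le1 // => /IH; rewrite ldivP.
Qed.

(** The bounds are words because a product of letters of F need not be a letter in the envelope. *)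
Definition filter_group (F : set L) : set envelope :=
  [set g | exists s, [/\ forall x, x \in s -> F x,
    env_word s <= g & g <= (env_word s)^-1]]%classic.

Definition group_filter (H : set envelope) : set L :=
  [set x | H (env x)]%classic.

Lemma filter_foldr (F : set L) s :
  mfilter F -> (forall x, x \in s -> F x) -> F (foldr *%g 1 s).
Proof.
move=> [F1 _ FM]; elim: s => //= x s IH sF; apply: FM.
  by apply: sF; rewrite mem_head.
by apply: IH => y ys; apply: sF; rewrite inE ys orbT.
Qed.

Lemma env_word_mem (H : set envelope) s : convex_lsubgroup H ->
  (forall x, x \in s -> H (env x)) -> H (env_word s).
Proof.
move=> [[H1 HM _] _ _]; elim: s => [|x s IH] sH; first exact: H1.
rewrite env_word_cons; apply: HM; first by apply: sH; rewrite mem_head.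
by apply: IH => y ys; apply: sH; rewrite inE ys orbT.
Qed.

Lemma filter_group_convex (F : set L) : order_convex (filter_group F).
Proof.
move=> g h k [s [sF sg gs]] [t [tF th ht]] gk kh.
exists (s ++ t); split.
- by move=> x; rewrite mem_cat => /orP[/sF|/tF].
- apply: le_trans gk; apply: le_trans sg.
  by rewrite env_word_cat -[leRHS]mulg1 leg_mul2lE env_word_le1.
- apply: le_trans kh _; apply: le_trans ht _.
  by rewrite legV env_word_cat -[leRHS]mul1g leg_mul2rE env_word_le1.
Qed.

Lemma filter_group_common (F : set L) (g h : envelope) :
  filter_group F g -> filter_group F h ->
  exists s, [/\ forall x, x \in s -> F x,
    (env_word s <= g) && (g <= (env_word s)^-1) &
    (env_word s <= h) && (h <= (env_word s)^-1)].
Proof.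
move=> [s [sF sg gs]] [t [tF th ht]]; exists (s ++ t).
have lel : env_word (s ++ t) <= env_word s.
  by rewrite env_word_cat -[leRHS]mulg1 leg_mul2lE env_word_le1.
have ler : env_word (s ++ t) <= env_word t.
  by rewrite env_word_cat -[leRHS]mul1g leg_mul2rE env_word_le1.
split; first by move=> x; rewrite mem_cat => /orP[/sF|/tF].
  by rewrite (le_trans lel) //= (le_trans gs) // legV.
by rewrite (le_trans ler) //= (le_trans ht) // legV.
Qed.

Lemma filter_groupP (F : set L) : convex_lsubgroup (filter_group F).
Proof.
split; last exact: filter_group_convex.
  split.
  - by exists [::]; rewrite /env_word /= cone_inj1 invg1 lexx.
  - move=> g h Fg Fh.
    have [s [sF /andP[sg gs] /andP[sh hs]]] := filter_group_common Fg Fh.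
    exists (s ++ s); split; rewrite ?env_word_cat ?invgM; [|exact: leg_mul..].
    by move=> x; rewrite mem_cat orbb => /sF.
  - move=> g [s [sF sg gs]]; exists s; split=> //; last by rewrite legV.
    by rewrite -[leLHS]invgK legV.
move=> g h Fg Fh.
have [s [sF /andP[sg gs] /andP[sh hs]]] := filter_group_common Fg Fh.
split; exists s; split=> //.
- by rewrite (le_trans sg) // leUl.
- by rewrite leUx gs.
- by rewrite lexI sg.
- by rewrite (le_trans _ gs) // leIl.
Qed.

Lemma filter_group_env (F : set L) x : F x -> filter_group F (env x).
Proof.
move=> Fx; exists [:: x]; rewrite lexx; split=> //.
  by move=> y; rewrite inE => /eqP->.
by rewrite (le_trans (env_le1 _)) // invg_ge1 env_le1.
Qed.

Lemma group_filterP (H : set envelope) : convex_lsubgroup H -> mfilter (group_filter H).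
Proof.
move=> [[H1 HM _] _ HC]; split; rewrite /group_filter /=.
- by rewrite env1.
- by move=> x y Hx xy; apply: (HC (env x) 1); rewrite ?env_leE ?env_le1.
- move=> x y Hx Hy; apply: (HC (env x * env y) 1) => //; first exact: HM.
    exact: env_mul_le.
  exact: env_le1.
Qed.

Lemma filter_groupK (F : set L) : mfilter F -> group_filter (filter_group F) = F.
Proof.
move=> fF; apply/seteqP; split=> x; last exact: filter_group_env.
move=> [s [sF sx _]]; have [_ Fup _] := fF.
exact: Fup (filter_foldr fF sF) (env_word_le sx).
Qed.

Lemma group_filterK (H : set envelope) :
  convex_lsubgroup H -> filter_group (group_filter H) = H.
Proof.
move=> cH; have [[H1 HM HV] HL HC] := cH; apply/seteqP; split=> g.
  move=> [s [sF sg gs]]; have Hs := env_word_mem cH sF.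
  exact: (HC _ _ _ Hs (HV _ Hs)).
move=> Hg; have [_ Hp] := HL _ _ Hg (HV _ Hg).
have {Hp} [_ Hp] := HL _ _ Hp H1.
(* This element of H bounds g from both sides and, being below 1, is a word. Each letter of the word
   lies between it and 1, hence belongs to H by convexity. *)
have pg : g `&` g^-1 `&` 1 <= g by rewrite (le_trans (leIl _ _)) // leIl.
have gp : g <= (g `&` g^-1 `&` 1)^-1.
  by rewrite -[leLHS]invgK legV (le_trans (leIl _ _)) // leIr.
have [s sE] := env_wordP (leIr 1 (g `&` g^-1)); rewrite sE in Hp pg gp.
exists s; split=> // x xs; rewrite /group_filter /=.
apply: (HC _ 1 _ Hp) => //; last exact: env_le1.
elim: s xs {sE Hp pg gp} => // y s IH; rewrite inE env_word_cons => /predU1P[->|/IH xs].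
  by rewrite -[leRHS]mulg1 leg_mul2lE env_word_le1.
by rewrite (le_trans _ xs) // -[leRHS]mul1g leg_mul2rE env_le1.
Qed.

Lemma filter_group_sub (F F' : set L) :
  (F `<=` F' -> filter_group F `<=` filter_group F')%classic.
Proof.
by move=> FF' g [s [sF sg gs]]; exists s; split=> // x /sF/FF'.
Qed.

Lemma filter_group_iso : family_iso (@mfilter d L) (@convex_lsubgroup _ envelope).
Proof.
exists filter_group group_filter.
- by move=> F _; apply: filter_groupP.
- exact: group_filterP.
- exact: filter_groupK.
- exact: group_filterK.
- exact: filter_group_sub.
- by move=> H H' HH' x /HH'.
Qed.

(** Since env y (env x ^ env y) = env x env y <= env (x y), the conjugate lies below env (y\(x y))
    by [env_res]; convexity then puts the residual in H. The right residual is reached from the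
    conjugate by the inverse of env y. *)
Lemma group_filter_normal (H : set envelope) :
  normal_convex_lsubgroup H -> normal_mfilter (group_filter H).
Proof.
move=> [cH HJ]; split; first exact: group_filterP.
have [_ _ HC] := cH.
move=> x y Hx; split; rewrite /group_filter /=.
  apply: (HC (env x ^ env y) 1); rewrite ?env_le1 //; first exact: HJ.
    by have [[]] := cH.
  rewrite -env_res; last first.
    rewrite -(mulVg (env y)) conjgE leg_mul2lE.
    by rewrite -[leRHS]mul1g leg_mul2rE env_le1.
  by rewrite conjgE mulVKg env_mul_le.
apply: (HC (env x ^ (env y)^-1) 1); rewrite ?env_le1 //; first exact: HJ.
  by have [[]] := cH.
rewrite -(leg_mul2rE (env y)) (env_factors (factors_rdiv (le_mulgl y x))).
by rewrite conjgE invgK mulgA mulgVK env_mul_le.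
Qed.

Lemma lsubgroup_conj_mem (F : set L) (g : envelope) :
  (forall x, F x -> filter_group F (env x ^ g)) ->
  forall h, filter_group F h -> filter_group F (h ^ g).
Proof.
move=> Fg h [s [sF sh hs]].
have cF := filter_groupP F; have [[F1 FM FV] _ _] := cF.
have Fs : filter_group F (env_word s ^ g).
  elim: s sF {sh hs} => [|x s IH] sF; first by rewrite conj1g.
  rewrite env_word_cons conjMg; apply: FM; first by apply/Fg/sF; rewrite mem_head.
  by apply: IH => y ys; apply: sF; rewrite inE ys orbT.
apply: (filter_group_convex Fs (FV _ Fs)); first exact: legJ.
by rewrite -conjVg; apply: legJ.
Qed.

(* With [o = k * m] in [L], [n = m\o] and [k' = o^-1 k o], both [n] and [k']  *)
(* lie in [F] by normality, and [k ^ m = n k' n^-1] since [m = o n^-1].       *)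
Lemma normal_filter_conj (F : set L) k m : normal_mfilter F -> F k ->
  filter_group F (env k ^ env m).
Proof.
move=> [fF nF] Fk; have [[_ FM FV] _ _] := filter_groupP F.
pose o := k * m; pose n := ldiv m o; pose y := ldiv k o; pose k' := ldiv y o.
have ok : o <= k := le_mulgl k m.
have om : o <= m := le_mulgr k m.
have oy : o <= y := le_ldiv k o.
have Fn : F n by have [] := nF k m Fk.
have Fk' : F k'.
  by rewrite /k' -[in X in ldiv _ X](gmv_mul_ldiv ok); have [] := nF k y Fk.
have ko := env_factors (factors_ldiv ok).
have mo := env_factors (factors_ldiv om).
have yo := env_factors (factors_ldiv oy).
suff -> : env k ^ env m = env n * env k' * (env n)^-1.
  by apply: (FM); [apply: (FM)|apply: FV]; apply: filter_group_env.
have -> : env m = env o * (env n)^-1 by rewrite -mo mulgK.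
have -> : env k' = env k ^ env o.
  by apply: (@mulgI _ (env o)); rewrite conjgE mulVKg -{1}ko -mulgA yo.
by rewrite conjgM conjgE invgK mulgA.
Qed.

(** Mirror image: with o = m * k in L, n = o/m and k' = o k o^-1 lie in F, and m = n^-1 o gives m k
    m^-1 = n^-1 k' n. *)
Lemma normal_filter_conjV (F : set L) k m : normal_mfilter F -> F k ->
  filter_group F (env k ^ (env m)^-1).
Proof.
move=> [fF nF] Fk; have [[_ FM FV] _ _] := filter_groupP F.
pose o := m * k; pose n := rdiv o m; pose y := rdiv o k; pose k' := rdiv o y.
have ok : o <= k := le_mulgr m k.
have om : o <= m := le_mulgl m k.
have oy : o <= y := le_rdiv o k.
have Fn : F n by have [] := nF k m Fk.
have Fk' : F k'.
  by rewrite /k' -[in X in rdiv X _](gmv_mul_rdiv ok); have [] := nF k y Fk.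
have yk := env_factors (factors_rdiv ok).
have nm := env_factors (factors_rdiv om).
have k'y := env_factors (factors_rdiv oy).
suff -> : env k ^ (env m)^-1 = (env n)^-1 * env k' * env n.
  by apply: (FM); [apply: (FM); [apply: FV|]|]; apply: filter_group_env.
have -> : env m = (env n)^-1 * env o by rewrite -nm mulKg.
have -> : env k' = env k ^ (env o)^-1.
  by apply: (@mulIg _ (env o)); rewrite conjgE invgK mulgA mulgVK -{1}yk mulgA k'y.
by rewrite invgM invgK conjgM [LHS]conjgE mulgA.
Qed.

Lemma filter_group_normal (F : set L) :
  normal_mfilter F -> normal_convex_lsubgroup (filter_group F).
Proof.
move=> nF; split; first exact: filter_groupP.
(* [N] is closed under products, but closure under inverses is not immediate, so words and their
   inverses are treated separately; every g is a quotient of two words. *)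
pose N (g : envelope) := forall h, filter_group F h -> filter_group F (h ^ g).
have NM g h : N g -> N h -> N (g * h).
  by move=> Ng Nh x Fx; rewrite conjgM; apply/Nh/Ng.
have N1 : N 1 by move=> x; rewrite conjg1.
have Ns s : N (env_word s) /\ N (env_word s)^-1.
  elim: s => [|x s [IH IHV]]; first by rewrite [env_word _]cone_inj1 invg1.
  rewrite env_word_cons invgM; split; apply: NM => //;
    apply: lsubgroup_conj_mem => k Fk; [exact: normal_filter_conj|].
  exact: normal_filter_conjV.
move=> h g Fh; suff : N g by apply.
have [u [v [/env_wordP[s ->] /env_wordP[t ->] ->]]] := lgroup_fraction g.
by apply: NM; [have [] := Ns s|have [] := Ns t].
Qed.

Lemma normal_filter_group_iso :
  family_iso (@normal_mfilter d L) (@normal_convex_lsubgroup _ envelope).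
Proof.
exists filter_group group_filter.
- exact: filter_group_normal.
- exact: group_filter_normal.
- by move=> F [fF _]; apply: filter_groupK.
- by move=> H [cH _]; apply: group_filterK.
- exact: filter_group_sub.
- by move=> H H' HH' x /HH'.
Qed.

End Envelope.

(** * Convex subalgebras and filters *)

Section NegativeCone.
Variables (d : Order.disp_t) (L : gmvAlgebraType d).

Definition neg_cone := {x : L | x <= 1}.

HB.instance Definition _ := SubChoice.on neg_cone.
HB.instance Definition _ := [SubChoice_isSubPOrder of neg_cone by <: with d].

Implicit Types x y z : neg_cone.

Lemma neg_le1 x : val x <= 1. Proof. by case: x. Qed.

Lemma neg_leE x y : (x <= y) = (val x <= val y).
Proof. by rewrite -(Order.le_val x y). Qed.

(** Right adjoint of the inclusion of the cone ([le_truncate]), so residuals and meets in the cone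
    are truncations of those in L. *)
Definition truncate (a : L) : neg_cone := exist _ (a `&` 1) (leIr 1 a).

Lemma le_truncate x (a : L) : (x <= truncate a) = (val x <= a).
Proof. by rewrite neg_leE lexI neg_le1 andbT. Qed.

Fact neg_join_subproof x y : val x `|` val y <= 1.
Proof. by rewrite leUx !neg_le1. Qed.

Fact neg_mul_subproof x y : val x * val y <= 1.
Proof. by rewrite -[leRHS]mulg1 le_mul ?neg_le1. Qed.

Definition neg_meet x y := truncate (val x `&` val y).
Definition neg_join x y : neg_cone := exist _ (val x `|` val y) (neg_join_subproof x y).
Definition neg_mul x y : neg_cone := exist _ (val x * val y) (neg_mul_subproof x y).
Definition neg_one : neg_cone := exist _ (1 : L) (lexx 1).
Definition neg_ldiv x y := truncate (ldiv (val x) (val y)).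
Definition neg_rdiv x y := truncate (rdiv (val x) (val y)).

Lemma neg_meetP x y z : (x <= neg_meet y z) = (x <= y) && (x <= z).
Proof. by rewrite le_truncate lexI !neg_leE. Qed.

Lemma neg_joinP x y z : (neg_join x y <= z) = (x <= z) && (y <= z).
Proof. by rewrite !neg_leE leUx. Qed.

HB.instance Definition _ :=
  Order.POrder_MeetJoin_isLattice.Build d neg_cone neg_meetP neg_joinP.

Lemma neg_mulA : associative neg_mul.
Proof. by move=> x y z; apply: val_inj; rewrite /= mulgA. Qed.

Lemma neg_mul1 : left_id neg_one neg_mul.
Proof. by move=> x; apply: val_inj; rewrite /= mul1g. Qed.

Lemma neg_mulr1 : right_id neg_one neg_mul.
Proof. by move=> x; apply: val_inj; rewrite /= mulg1. Qed.

HB.instance Definition _ := isMonoid.Build neg_cone neg_mulA neg_mul1 neg_mulr1.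

Lemma neg_ldivP x y z : (x * y <= z) = (y <= neg_ldiv x z).
Proof. by rewrite le_truncate neg_leE ldivP. Qed.

Lemma neg_rdivP x y z : (x * y <= z) = (x <= neg_rdiv z y).
Proof. by rewrite le_truncate neg_leE rdivP. Qed.

HB.instance Definition _ := isResiduated.Build d neg_cone neg_ldivP neg_rdivP.

Lemma neg_lex1 x : x <= 1.
Proof. by rewrite neg_leE neg_le1. Qed.

Lemma neg_rdivE x y : rdiv x (ldiv y x `&` 1) = x `|` y.
Proof.
rewrite (meet_idPl (neg_lex1 _)); apply: val_inj.
by rewrite /= rdivE (meet_idPl (neg_join_subproof x y)).
Qed.

Lemma neg_ldivE x y : ldiv (rdiv x y `&` 1) x = x `|` y.
Proof.
rewrite (meet_idPl (neg_lex1 _)); apply: val_inj.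
by rewrite /= ldivE (meet_idPl (neg_join_subproof x y)).
Qed.

HB.instance Definition _ := isGMV.Build d neg_cone neg_rdivE neg_ldivE.
HB.instance Definition _ := isIntegral.Build d neg_cone neg_lex1.

End NegativeCone.

(** * Positive elements of a GMV-algebra are units *)

Section Units.
Variables (d : Order.disp_t) (L : gmvAlgebraType d).
Implicit Types x y k p q : L.

(** For 1 <= p, [gmv_mul_ldiv] makes p\1 a right inverse and [gmv_mul_rdiv] makes 1/p a left
    inverse; the two then coincide. *)
Lemma gmv_pos_unit p : 1 <= p -> exists q, [/\ q <= 1, p * q = 1 & q * p = 1].
Proof.
move=> p1; have := gmv_mul_ldiv p1; have := gmv_mul_rdiv p1.
move: (ldiv p 1) (rdiv 1 p) => q r rp pq.
exists q; split=> //; first by rewrite -[q]mul1g -{2}pq le_mul2r.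
by have -> : q = r by rewrite -[q]mul1g -{1}rp -mulgA pq mulg1.
Qed.

(** If x k <= 1, then x <= p for p = 1/k >= 1, a unit with inverse q. From p k <= 1 follows k <= q,
    so k x <= q p = 1. In particular 1/k = k\1 for k <= 1. *)
Lemma mul_le1C x k : k <= 1 -> (x * k <= 1) = (k * x <= 1).
Proof.
move=> k1; apply/idP/idP => [xk|kx].
  have [|q [_ pq qp]] := @gmv_pos_unit (rdiv 1 k); first by rewrite le1_rdiv.
  have kq : k <= q.
    by rewrite -[k]mul1g -qp -mulgA -[leRHS]mulg1 le_mul2l ?rdivK.
  by rewrite -qp le_mul // -rdivP.
have [|q [_ pq qp]] := @gmv_pos_unit (ldiv k 1); first by rewrite le1_ldiv.
have kq : k <= q.
  by rewrite -[k]mulg1 -pq mulgA -[leRHS]mul1g le_mul2r ?ldivK.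
by rewrite -pq le_mul // -ldivP.
Qed.

Lemma gmv_factor x : exists p z, [/\ 1 <= p, z <= 1 & x = p * z].
Proof.
have [|q [q1 pq qp]] := @gmv_pos_unit (x `|` 1); first exact: leUr.
exists (x `|` 1), (q * x); rewrite leUr mulgA pq mul1g; split=> //.
by rewrite -qp le_mul2l // leUl.
Qed.

End Units.

(** * Convex subalgebras against filters of the negative cone *)

Section ConvexSubalgebras.
Variables (d : Order.disp_t) (L : gmvAlgebraType d).
Implicit Types (H : set L) (F : set (neg_cone L)).

Definition neg_part H : set (neg_cone L) := [set k | H (val k)]%classic.

(** The union of the intervals from k to 1/k with k in F. *)
Definition neg_gen F : set L :=
  [set x | exists k : neg_cone L, [/\ F k, val k <= x & x * val k <= 1]]%classic.

Lemma neg_gen_common F x y : mfilter F -> neg_gen F x -> neg_gen F y ->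
  exists k : neg_cone L, [/\ F k, (val k <= x) && (x * val k <= 1) &
    (val k <= y) && (y * val k <= 1)].
Proof.
move=> [_ _ FM] [k [Fk kx xk]] [l [Fl ly yl]]; exists (k * l).
have klk : val (k * l) <= val k by have := le_mulgl k l; rewrite neg_leE.
have kll : val (k * l) <= val l by have := le_mulgr k l; rewrite neg_leE.
split; first exact: FM.
  by rewrite (le_trans klk) //= (le_trans (le_mul2l _ klk)).
by rewrite (le_trans kll) //= (le_trans (le_mul2l _ kll)).
Qed.

Lemma neg_genP F : mfilter F -> convex_subalgebra (neg_gen F).
Proof.
move=> fF; have [F1 _ FM] := fF; split; last first.
  move=> a b x Ha Hb ax xb.
  have [k [Fk /andP[ka _] /andP[_ bk]]] := neg_gen_common fF Ha Hb.
  exists k; split=> //; first exact: le_trans ax.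
  exact: le_trans (le_mul2r _ xb) bk.
split.
- by exists 1; rewrite mulg1 lexx.
- move=> x y Hx Hy.
  have [k [Fk /andP[kx xk] /andP[ky yk]]] := neg_gen_common fF Hx Hy.
  exists (k * k); split; [exact: FM|exact: le_mul|].
  rewrite /= -mulgA (mulgA y); apply: le_trans xk.
  by rewrite le_mul2l // -[leRHS]mul1g le_mul2r.
- move=> x y Hx Hy.
  have [k [Fk /andP[kx xk] /andP[ky yk]]] := neg_gen_common fF Hx Hy.
  exists (k * k); split; first exact: FM.
    by rewrite /= -ldivP mulgA (le_trans _ ky) // -[leRHS]mul1g le_mul2r.
  (* Moving k k to the left of x\y allows the bound k (x\y) <= x (x\y) <= y, after which k y <= 1
     concludes. *)
  rewrite mul_le1C ?neg_le1 //= -mulgA.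
  rewrite mul_le1C ?neg_le1 // in yk; apply: le_trans yk; apply: le_mul2l.
  exact: le_trans (le_mul2r _ kx) (ldivK _ _).
- move=> x y Hx Hy.
  have [k [Fk /andP[kx xk] /andP[ky yk]]] := neg_gen_common fF Hx Hy.
  exists (k * k); split; first exact: FM.
    rewrite /= -rdivP -mulgA (le_trans _ kx) // -[leRHS]mulg1 le_mul2l //.
    by rewrite -mul_le1C ?neg_le1.
  rewrite /= mulgA (le_trans _ xk) // le_mul2r //.
  exact: le_trans (le_mul2l _ ky) (rdivK _ _).
- move=> x y Hx Hy.
  have [k [Fk /andP[kx xk] /andP[ky yk]]] := neg_gen_common fF Hx Hy.
  split; exists k; split=> //.
  + by rewrite (le_trans kx) // leUl.
  + by rewrite rdivP leUx -!rdivP xk.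
  + by rewrite lexI kx.
  + by rewrite (le_trans _ xk) // le_mul2r // leIl.
Qed.

Lemma neg_partP H : convex_subalgebra H -> mfilter (neg_part H).
Proof.
move=> [[H1 HM _ _ _] HC]; split=> //.
- by move=> x y Hx xy; apply: (HC (val x) 1) => //; rewrite neg_le1.
- by move=> x y Hx Hy; apply: HM.
Qed.

Lemma neg_partK H : convex_subalgebra H -> neg_gen (neg_part H) = H.
Proof.
move=> [[H1 HM Hl Hr HL] HC]; apply/seteqP; split=> x.
  move=> [k [Hk kx xk]]; apply: (HC (val k) (rdiv 1 (val k))) => //.
    exact: Hr.
  by rewrite -rdivP.
(* The witness is k = x [&] (x\1) [&] 1: the first term gives k <= x, the second x k <= 1. *)
move=> Hx; have [_ Hk] := HL _ _ Hx (Hl _ _ Hx H1).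
have {Hk} [_ Hk] := HL _ _ Hk H1.
exists (truncate (x `&` ldiv x 1)); split=> //=.
  by rewrite (le_trans (leIl _ _)) // leIl.
by rewrite ldivP (le_trans (leIl _ _)) // leIr.
Qed.

Lemma neg_genK F : mfilter F -> neg_part (neg_gen F) = F.
Proof.
move=> [F1 Fup FM]; apply/seteqP; split=> x.
  by move=> [k [Fk kx _]]; apply: Fup Fk _; rewrite neg_leE.
by move=> Fx; exists x; split=> //; apply: neg_le1 (x * x).
Qed.

Lemma neg_part_sub H H' : (H `<=` H' -> neg_part H `<=` neg_part H')%classic.
Proof. by move=> HH' k /HH'. Qed.

Lemma neg_gen_sub F F' : (F `<=` F' -> neg_gen F `<=` neg_gen F')%classic.
Proof. by move=> FF' x [k [/FF' Fk kx xk]]; exists k. Qed.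

Lemma neg_part_normal H : normal_convex_subalgebra H -> normal_mfilter (neg_part H).
Proof.
move=> [cH nH]; split; first exact: neg_partP.
by move=> x y Hx; apply: nH.
Qed.

(** For y in the cone this is normality. For a unit p >= 1 with inverse q, multiply the inequalities
    for q by p on both sides, which exchanges the two claims. Every y is a product p z of these two
    kinds ([gmv_factor]). *)
Lemma normal_filter_commute F (y : L) (k : neg_cone L) : normal_mfilter F -> F k ->
  (exists2 k' : neg_cone L, F k' & y * val k' <= val k * y) /\
  (exists2 k' : neg_cone L, F k' & val k' * y <= y * val k).
Proof.
move=> [fF nF].
have neg (z : L) l : z <= 1 -> F l ->
    (exists2 l' : neg_cone L, F l' & z * val l' <= val l * z) /\
    (exists2 l' : neg_cone L, F l' & val l' * z <= z * val l).
  move=> z1 Fl; pose z' : neg_cone L := exist _ z z1.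
  have [Fl1 Fl2] := nF l z' Fl.
  split; [exists (ldiv z' (l * z'))|exists (rdiv (z' * l) z')] => //.
    exact: (ldivK z' (l * z')).
  exact: (rdivK (z' * l) z').
have [p [z [p1 z1 ->]]] := gmv_factor y.
have [q [q1 pq qp]] := gmv_pos_unit p1.
have unit l : F l ->
    (exists2 l' : neg_cone L, F l' & p * val l' <= val l * p) /\
    (exists2 l' : neg_cone L, F l' & val l' * p <= p * val l).
  move=> Fl; have [[m Fm qm] [n Fn nq]] := neg q l q1 Fl; split.
    exists n => //; have := le_mul2r p (le_mul2l p nq).
    by rewrite !mulgA pq mul1g -(mulgA (p * val n) q p) qp mulg1.
  exists m => //; have := le_mul2r p (le_mul2l p qm).
  by rewrite !mulgA pq mul1g -(mulgA (p * val l) q p) qp mulg1.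
move=> Fk; split.
  have [[l Fl lk] _] := unit k Fk; have [[m Fm ml] _] := neg z l z1 Fl.
  exists m => //; rewrite -mulgA (le_trans (le_mul2l p ml)) //.
  by rewrite !mulgA le_mul2r.
have [_ [l Fl lk]] := neg z k z1 Fk; have [_ [m Fm ml]] := unit l Fl.
exists m => //; rewrite -mulgA; apply: le_trans (le_mul2l p lk).
by rewrite !mulgA le_mul2r.
Qed.

Lemma neg_gen_normal F : normal_mfilter F -> normal_convex_subalgebra (neg_gen F).
Proof.
move=> nF; have [fF _] := nF; split; first exact: neg_genP.
have Fle1 (x : L) (k : neg_cone L) : F k -> val k <= x -> neg_gen F (x `&` 1).
  move=> Fk kx; exists k; split=> //; first by rewrite lexI kx neg_le1.
  by rewrite -[leRHS]mulg1 le_mul ?leIr ?neg_le1.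
move=> x y [k [Fk kx xk]].
have [[l Fl ly] [m Fm my]] := normal_filter_commute y nF Fk.
split; [apply: (Fle1 _ l Fl)|apply: (Fle1 _ m Fm)].
  (* The chain is y l <= k y <= x y, hence l <= y\(x y). *)
  by rewrite -ldivP (le_trans ly) // le_mul2r.
by rewrite -rdivP (le_trans my) // le_mul2l.
Qed.

Lemma neg_part_iso : family_iso (@convex_subalgebra d L) (@mfilter _ (neg_cone L)).
Proof.
exists neg_part neg_gen.
- exact: neg_partP.
- exact: neg_genP.
- exact: neg_partK.
- exact: neg_genK.
- exact: neg_part_sub.
- exact: neg_gen_sub.
Qed.

Lemma normal_neg_part_iso :
  family_iso (@normal_convex_subalgebra d L) (@normal_mfilter _ (neg_cone L)).
Proof.
exists neg_part neg_gen.
- exact: neg_part_normal.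
- exact: neg_gen_normal.
- by move=> H [cH _]; apply: neg_partK.
- by move=> F [fF _]; apply: neg_genK.
- exact: neg_part_sub.
- exact: neg_gen_sub.
Qed.

End ConvexSubalgebras.

Theorem theorem7p2 :
  (forall (d : Order.disp_t) (L : gmvAlgebraType d),
     exists (d' : Order.disp_t) (G : lgroupType d'),
       lattice_isomorphic (closed_set (convex_subalgebras L))
                          (closed_set (convex_lsubgroups G))) /\
  (forall (d : Order.disp_t) (L : gmvAlgebraType d),
     exists (d' : Order.disp_t) (G : lgroupType d'),
       lattice_isomorphic (closed_set (normal_convex_subalgebras L))
                          (closed_set (normal_convex_lsubgroups G))).
Proof.
split=> d L; exists (fractions_display), (envelope (neg_cone L));
  apply: closed_set_isomorphic.
  exact: family_iso_trans (neg_part_iso L) (filter_group_iso (neg_cone L)).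
exact: family_iso_trans (normal_neg_part_iso L) (normal_filter_group_iso (neg_cone L)).
Qed.
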